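(* Let $d\ge1$, $0<\beta\le1$, $C>0$, $M>0$, and let $\mathcal{F}$ be the class of functions $m:\mathbb{R}^d\to\mathbb{R}$ such that $|m(x)-m(x')|\le C\|x-x'\|^\beta$ for all $x,x'\in\mathbb{R}^d$, the support of $m$ is contained in $[0,1]^d$, and $m$ is bounded from above by $M$. Consider raw data $(X_1,Y_1),\dots,(X_n,Y_n)$ that are i.i.d. copies of $(X,Y)$ with $$Y=m(X)+\eta,$$ where $X$ is uniformly distributed on $[0,1]^d$, $\eta$ is uniformly distributed on $[-1/2,1/2]$ and independent of $X$, and $m\in\mathcal{F}$. Then $$\inf_{\tilde m,\;Q\in\mathcal{Q}_\alpha}\ \sup_{m\in\mathcal{F}}\ \mathbf{E}\left[\int_{[0,1]^d}(\tilde m(x)-m(x))^2\,\mathrm{d}x\right]\gtrsim \min\left\{\left(n(e^\alpha-1)^2\right)^{-\beta/(\beta+d)},1\right\},$$ where the infimum is taken over all (potentially sequentially interactive) $\alpha$-locally differentially private mechanisms $Q\in\mathcal{Q}_\alpha$ and all estimators $\tilde m$ based on the private sample $Z_1,\dots,Z_n$ of size $n$ generated by $Q$ from the raw data.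
   Context: Sequentially interactive privacy mechanisms: a mechanism $Q$ is given by conditional probability measures (Markov kernels) $Q_i(\,\cdot\mid (X_i,Y_i)=(x_i,y_i),Z_1=z_1,\dots,Z_{i-1}=z_{i-1})$, $i=1,\dots,n$, on measurable spaces $(\mathcal{Z}_i,\mathscr{Z}_i)$, according to which the privatized datum $Z_i$ is drawn given the raw datum $(X_i,Y_i)=(x_i,y_i)$ and the previously generated privatized data. For a privacy parameter $\alpha\in[0,\infty]$, $\mathcal{Q}_\alpha$ denotes the set of all such mechanisms that are $\alpha$-locally differentially private, i.e. $$\frac{Q_i(A\mid (X_i,Y_i)=(x,y),Z_{i-1}=z_{i-1},\dots,Z_1=z_1)}{Q_i(A\mid (X_i,Y_i)=(x',y'),Z_{i-1}=z_{i-1},\dots,Z_1=z_1)}\le e^\alpha$$ for all $i$, all $A\in\mathscr{Z}_i$, all $z_j\in\mathcal{Z}_j$ ($j=1,\dots,i-1$), and all potential values $(x,y),(x',y')$ of the raw data. The spaces $(\mathcal{Z}_i,\mathscr{Z}_i)$ may be chosen freely as part of the mechanism. Non-interactive mechanisms (where $Q_i$ does not depend on $z_1,\dots,z_{i-1}$) are included. An estimator $\tilde m$ is any measurable function of $(Z_1,\dots,Z_n)$ with values in functions on $[0,1]^d$. The expectation is with respect to the distribution of $(Z_1,\dots,Z_n)$ when the regression function is $m$. Notation: $a\gtrsim b$ means $a\ge\kappa b$ for a constant $\kappa>0$ not depending on $n$ or $\alpha$ (it may depend on $d,\beta,C,M$). For $\alpha=0$ the right-hand side is read as $1$ (up to the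 constant), and for $\alpha=\infty$ as $0$. *)

(* Defs.v *)
From HB Require Import structures.
From mathcomp Require Import all_boot all_order all_algebra.
From mathcomp Require Import all_classical all_reals all_analysis.
From mathcomp Require Import measurable_realfun.
From mathcomp Require Import lra.

Set Implicit Arguments.
Unset Strict Implicit.
Unset Printing Implicit Defensive.

Import Order.TTheory GRing.Theory Num.Theory.
Import numFieldNormedType.Exports.

Local Open Scope classical_set_scope.
Local Open Scope ring_scope.

Section euclidean_space.
Context {R : realType}.
Implicit Types d : nat.

(* R^d is d.-tuple R with the product sigma-algebra; the norm is Euclidean. *)
Definition edist d (x y : d.-tuple R) : R :=
  Num.sqrt (\sum_(i < d) (tnth x i - tnth y i) ^+ 2).

Lemma edistC d (x y : d.-tuple R) : edist x y = edist y x.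
Proof.
by rewrite /edist; congr Num.sqrt; apply: eq_bigr => i _; rewrite -sqrrN opprB.
Qed.

Lemma measurable_edistr d (y : d.-tuple R) :
  measurable_fun setT (fun x => edist x y).
Proof.
rewrite (_ : (fun x => _) = fun x : d.-tuple R =>
    (\sum_(i < d) (tnth x i - tnth y i) ^+ 2) `^ 2^-1); last first.
  by apply/funext => x; rewrite powR12_sqrt// sumr_ge0// => i _; exact: sqr_ge0.
apply: (measurableT_comp (measurable_powR _)).
apply: measurable_sum => i.
apply: measurable_funX; apply: measurable_funB => //.
exact: measurable_tnth.
Qed.

Lemma edist_le d (x y : d.-tuple R) (e : R) : 0 <= e ->
  (forall i, `|tnth x i - tnth y i| <= e) -> edist x y <= d%:R * e.
Proof.
move=> e0 xye; rewrite /edist -(ger0_norm (_ : 0 <= d%:R * e)) ?mulr_ge0// -sqrtr_sqr.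
apply: ler_wsqrtr; rewrite exprMn.
apply: (@le_trans _ _ (\sum_(i < d) e ^+ 2)).
  apply: ler_sum => i _; rewrite -real_normK ?num_real//.
  by rewrite lerXn2r ?nnegrE.
rewrite sumr_const card_ord -[leLHS]mulr_natl; apply: ler_wpM2r; first exact: sqr_ge0.
by rewrite -natrX ler_nat; case: (d) => // d'; rewrite expnS leq_pmulr.
Qed.

Lemma edist_rat d (x : d.-tuple R) (e : R) : 0 < e ->
  exists q : d.-tuple rat, edist x (map_tuple ratr q) <= e.
Proof.
move=> e0; pose e' := e / d.+1%:R.
have e'0 : 0 < e' by rewrite divr_gt0.
have H (i : 'I_d) : {q : rat | `|tnth x i - ratr q| <= e'}.
  apply: cid; have [|q] := @rat_in_itvoo R (tnth x i - e') (tnth x i + e').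
    by lra.
  rewrite in_itv/= => /andP[h1 h2]; exists q.
  by rewrite ler_norml; apply/andP; split; lra.
exists [tuple projT1 (H i) | i < d].
apply: (@le_trans _ _ (d%:R * e')).
  apply: edist_le; first exact: ltW.
  by move=> i; rewrite tnth_map tnth_mktuple; case: (H i).
rewrite /e' mulrCA ler_piMr ?ltW// ltr_pdivrMr ?ltr0n// mul1r.
by rewrite ltr_nat.
Qed.

Definition holder d (beta C : R) (m : d.-tuple R -> R) :=
  forall x x', `|m x - m x'| <= C * edist x x' `^ beta.

(* Justifies taking the regression functions in {mfun _ >-> _} below: for
   beta > 0 the Hoelder condition already implies Borel measurability. *)
Lemma holder_measurable d beta C (m : d.-tuple R -> R) : 0 < beta ->
  holder beta C m -> measurable_fun setT m.
Proof.
move=> b0 mH.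
have mlt a : measurable [set x | a < m x].
  pose g (q : d.-tuple rat) x :=
    m (map_tuple ratr q) - `|C| * edist x (map_tuple ratr q) `^ beta.
  have -> : [set x | a < m x] = \bigcup_q (g q @^-1` `]a, +oo[).
    apply/seteqP; split => [x /= amx|x [q _] /=]; last first.
      rewrite in_itv/= andbT => /lt_le_trans; apply.
      have := mH (map_tuple ratr q) x; rewrite edistC.
      move=> /(le_trans (ler_norm _)).
      have := ler_wpM2r (powR_ge0 (edist x (map_tuple ratr q)) beta) (ler_norm C).
      by rewrite /g; lra.
    pose del := (m x - a) / 4.
    have del0 : 0 < del by rewrite /del; lra.
    have C0 : 0 < `|C| + 1 by rewrite ltr_wpDl.
    have [|q xq] := @edist_rat d x ((del / (`|C| + 1)) `^ beta^-1).
      by rewrite powR_gt0// divr_gt0.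
    exists q => //=; rewrite in_itv/= andbT /g.
    have xqb : `|C| * edist x (map_tuple ratr q) `^ beta <= del.
      have : edist x (map_tuple ratr q) `^ beta <= del / (`|C| + 1).
        have -> : del / (`|C| + 1) = ((del / (`|C| + 1)) `^ beta^-1) `^ beta.
          by rewrite -powRrM mulVf ?lt0r_neq0// powRr1// divr_ge0// ltW.
        by apply: ge0_ler_powR; rewrite ?nnegrE ?sqrtr_ge0 ?powR_ge0 ?(ltW b0).
      move=> /(ler_wpM2l (normr_ge0 C)) /le_trans; apply.
      rewrite mulrCA ler_piMr ?(ltW del0)// ler_pdivrMr// mul1r.
      by rewrite lerDl.
    have := mH x (map_tuple ratr q) => /(le_trans (ler_norm _)).
    have := ler_wpM2r (powR_ge0 (edist x (map_tuple ratr q)) beta) (ler_norm C).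
    by move: xqb; rewrite /del; lra.
  apply: countable_bigcupT_measurable; first exact: countableP.
  move=> q; rewrite -[X in measurable X]setTI.
  have mg : measurable_fun setT (g q).
    apply: measurable_funB => //; apply: measurable_funM => //.
    apply: (measurableT_comp (measurable_powR beta)).
    exact: measurable_edistr.
  by apply: mg => //; exact: measurable_itv.
apply: (measurability _ (RGenOInfty.measurableE R)).
move=> _ [_ [a ->] <-]; rewrite setTI.
rewrite (_ : _ @^-1` _ = [set x | a < m x])//.
by apply/seteqP; split => x /=; rewrite in_itv/= andbT.
Qed.

Definition cube d : set (d.-tuple R) :=
  [set x | forall i, 0 <= tnth x i <= 1].
Arguments cube d _ : clear implicits.

Lemma measurable_cube d : measurable (cube d).
Proof.
have -> : cube d = \bigcap_(i : 'I_d) ((@tnth d R)^~ i @^-1` `[0, 1]).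
  apply/seteqP; split => x xd i; first by move=> _ /=; rewrite in_itv/=; exact: xd.
  by have := xd i I; rewrite /= in_itv/=.
apply: fin_bigcap_measurable; first exact: finite_finset.
move=> i _; rewrite -[X in measurable X]setTI.
by apply: measurable_tnth => //; exact: measurable_itv.
Qed.

(* lebesgue_measure and uniform_prob live on measurableTypeR R, whose display is not
   that of the measurableType inferred from R. *)
Definition tcons d (w : measurableTypeR R * d.-tuple R) : d.+1.-tuple R :=
  [tuple of w.1 :: w.2].

Lemma measurable_tcons d : measurable_fun setT (@tcons d).
Proof. by apply: measurable_cons; [exact: measurable_fst|exact: measurable_snd]. Qed.

HB.instance Definition _ d :=
  isMeasurableFun.Build _ _ _ _ (@tcons d) (@measurable_tcons d).

Lemma measurable_uncons d : measurable_fun setT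
  (fun x : d.+1.-tuple R => (thead x : measurableTypeR R, [tuple of behead x])).
Proof.
apply: measurable_fun_pair; last exact: measurable_behead.
exact: measurable_tnth.
Qed.

Section lebesgue_succ.
Context d (mu : {sigma_finite_measure set (d.-tuple R) -> \bar R}).
Local Open Scope ereal_scope.

Definition lebesgue_succ : set (d.+1.-tuple R) -> \bar R :=
  pushforward (@lebesgue_measure R \x mu) (@tcons d).

Let lebesgue_succ0 : lebesgue_succ set0 = 0.
Proof. by rewrite /lebesgue_succ /pushforward preimage_set0 measure0. Qed.

Let lebesgue_succ_ge0 A : 0 <= lebesgue_succ A.
Proof. by rewrite /lebesgue_succ /pushforward measure_ge0. Qed.

Let lebesgue_succ_sigma_additive : semi_sigma_additive lebesgue_succ.
Proof.
have := @measure_semi_sigma_additive _ _ _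
  (measure_function_pushforward__canonical__measure_function_Measure
    (@lebesgue_measure R \x mu) (@measurable_tcons d)).
exact.
Qed.

HB.instance Definition _ := isMeasure.Build _ _ _ lebesgue_succ
  lebesgue_succ0 lebesgue_succ_ge0 lebesgue_succ_sigma_additive.

Let lebesgue_succ_sigma_finite : sigma_finite setT lebesgue_succ.
Proof.
have /sigma_finiteP[F [TF ndF Foo]] := sigma_finiteT (@lebesgue_measure R).
have /sigma_finiteP[G [TG ndG Goo]] := sigma_finiteT mu.
pose uncons (x : d.+1.-tuple R) : measurableTypeR R * d.-tuple R :=
  (thead x, [tuple of behead x]).
exists (fun n => uncons @^-1` (F n `*` G n)).
  rewrite -preimage_bigcup; apply/esym/seteqP; split => // x _.
  have [n _ Fn] : (\bigcup_n F n) (thead x) by rewrite -TF.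
  have [k _ Gk] : (\bigcup_n G n) [tuple of behead x] by rewrite -TG.
  exists (maxn n k) => //; split => /=.
  - by move: Fn; exact/subsetPset/ndF/leq_maxl.
  - by move: Gk; exact/subsetPset/ndG/leq_maxr.
move=> n; have [mFn Fnoo] := Foo n; have [mGn Gnoo] := Goo n; split.
  rewrite -[X in measurable X]setTI; apply: measurable_uncons => //.
  exact: measurableX.
rewrite /lebesgue_succ /pushforward -comp_preimage.
rewrite (_ : (uncons \o _) = id); last first.
  by apply/funext => -[x t] /=; congr pair; exact: val_inj.
rewrite preimage_id product_measure1E//.
by rewrite lte_mul_pinfty// ge0_fin_numE.
Qed.

HB.instance Definition _ := Measure_isSigmaFinite.Build _ _ _ lebesgue_succ
  lebesgue_succ_sigma_finite.

End lebesgue_succ.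

Fixpoint lebesgue_tuple d : {sigma_finite_measure set (d.-tuple R) -> \bar R} :=
  match d with
  | 0 => \d_[tuple]
  | d'.+1 => lebesgue_succ (lebesgue_tuple d')
  end.

Lemma lebesgue_cube d : lebesgue_tuple d (cube d) = 1%E.
Proof.
elim: d => [|d IH].
  by rewrite /= diracE mem_set//= => -[].
rewrite /= /lebesgue_succ /pushforward.
have -> : @tcons d @^-1` cube d.+1 = `[0, 1]%classic `*` cube d.
  apply/seteqP; split => [[x t] /= H|[x t] /= [x01 H] i].
    split; first by have := H ord0; rewrite in_itv.
    by move=> i; have := H (lift ord0 i); rewrite tnthS.
  by case: (unliftP ord0 i) => [j ->|->]; rewrite ?tnthS//; move: x01; rewrite in_itv.
rewrite product_measure1E//; last exact: measurable_cube.
rewrite IH mule1; have := @lebesgue_measure_itv R `[0, 1].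
by rewrite /= lte_fin ltr01 oppr0 adde0.
Qed.

(* No normalisation is needed: [0,1]^d has volume 1 by lebesgue_cube. *)
Definition uniform_cube d : set (d.-tuple R) -> \bar R :=
  mrestr (lebesgue_tuple d) (@measurable_cube d).
Arguments uniform_cube d _ : clear implicits.

HB.instance Definition _ d := Measure.on (uniform_cube d).

Lemma uniform_cube_setT d : uniform_cube d [set: d.-tuple R] = 1%E.
Proof. by rewrite /uniform_cube /mrestr setTI lebesgue_cube. Qed.

HB.instance Definition _ d := Measure_isProbability.Build _ _ _
  (uniform_cube d) (@uniform_cube_setT d).

End euclidean_space.

Arguments cube {R} d _.
Arguments uniform_cube {R} d _.
Arguments lebesgue_tuple {R} d.

Section regression_model.
Context {R : realType}.
Variables (d : nat) (beta C M : R).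

(* Since [0,1]^d is closed, it contains the (closed) support of m as soon as it
   contains the points where m does not vanish. *)
Definition regression_class : set {mfun d.-tuple R >-> R} :=
  [set m | [/\ holder beta C m, [set x | m x != 0] `<=` cube d & forall x, m x <= M]].

Lemma half_lt : (- 2^-1 : R) < 2^-1.
Proof. by rewrite gtrN// invr_gt0. Qed.

Definition noise : probability (measurableTypeR R) R := uniform_prob half_lt.

Definition raw_datum (m : d.-tuple R -> R) (w : d.-tuple R * measurableTypeR R) :
  d.-tuple R * R := (w.1, m w.1 + w.2).

Lemma measurable_raw_datum (m : {mfun d.-tuple R >-> R}) :
  measurable_fun setT (raw_datum m).
Proof.
apply: measurable_fun_pair; first exact: measurable_fst.
apply: measurable_funD; last exact: measurable_snd.
exact: (measurableT_comp (measurable_funPT m) measurable_fst).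
Qed.

HB.instance Definition _ (m : {mfun d.-tuple R >-> R}) :=
  isMeasurableFun.Build _ _ _ _ (raw_datum m) (measurable_raw_datum m).

(* The law of (X, m X + eta); X and eta are independent, hence the product. *)
Definition raw_law (m : {mfun d.-tuple R >-> R}) :
    probability (d.-tuple R * R)%type R :=
  distribution (uniform_cube d \x noise)%E (raw_datum m).

(* The values (x, y) that a raw datum can take when m ranges over the class. *)
Definition potential_raw : set (d.-tuple R * R) :=
  [set w | cube d w.1 /\
     exists2 m, regression_class m & `|w.2 - m w.1| <= 2^-1].

End regression_model.

Section mechanisms.
Context {R : realType} {dT : measure_display} (T : measurableType dT).
Local Open Scope ereal_scope.

(* [mechanism H n] is a sequentially interactive mechanism releasing Z_1, ..., Z_n
   with H = unit * Z_1 * ... * Z_n (left-nested); the output spaces are chosen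
   freely, and the last kernel draws Z_n given (Z_1, ..., Z_(n-1)) and the raw
   datum, an element of T. *)
Inductive mechanism : forall d, measurableType d -> nat -> Type :=
| no_release : mechanism unit 0
| release d (H : measurableType d) n d' (Z : measurableType d') :
    mechanism H n -> (R.-pker (H * T)%type ~> Z) -> mechanism (H * Z)%type n.+1.

(* In \bar R one has 0^-1 = +oo and 0 * +oo = 0, so the ratio below is 0 when both
   measures vanish, +oo when only the denominator does, and there is no
   constraint for alpha = +oo. *)
Fixpoint locally_private (alpha : \bar R) (V : set T) d (H : measurableType d) n
    (Q : mechanism H n) : Prop :=
  match Q with
  | no_release => True
  | release _ H' _ _ Z Q' k => locally_private alpha V Q' /\
      forall (A : set Z) (h : H') (v v' : T), measurable A -> V v -> V v' ->
        k (h, v) A / k (h, v') A <= expeR alpha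
  end.

Section step.
Context d (H : measurableType d) d' (Z : measurableType d').
Variables (L : probability H R) (P : probability T R).
Variable k : R.-pker (H * T)%type ~> Z.

(* The law of (h, z) for h ~ L, an independent v ~ P, and z ~ k (h, v); the raw
   datum v is then discarded. *)
Definition release_law (A : set (H * Z)) : \bar R :=
  \int[L \x P]_w k w (xsection A w.1).

Let release_law0 : release_law set0 = 0.
Proof.
by apply: integral0_eq => w _; rewrite xsection0 measure0.
Qed.

Let release_law_ge0 A : 0 <= release_law A.
Proof. exact: integral_ge0. Qed.

Lemma measurable_release A : measurable A ->
  measurable_fun setT (fun w => k w (xsection A w.1)).
Proof.
move=> mA.
have := @measurable_fun_xsection_finite_kernel _ _ _ _ _ k
  ((fun x : (H * T) * Z => (x.1.1, x.2)) @^-1` A).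
have -> : (fun w => k w (xsection A w.1)) = fun w => k w
    (xsection ((fun x : (H * T) * Z => (x.1.1, x.2)) @^-1` A) w).
  by apply/funext => w; congr (k w _); rewrite !xsectionE.
apply; rewrite inE -[X in measurable X]setTI.
apply: measurable_fun_pair => //.
exact: measurableT_comp.
Qed.

Let release_law_sigma_additive : semi_sigma_additive release_law.
Proof.
move=> F mF tF mUF; rewrite [X in _ --> X](_ : _ =
  \int[L \x P]_w (\sum_(n <oo) k w (xsection (F n) w.1))); last first.
  apply: eq_integral => w _; rewrite xsection_bigcup.
  apply/esym/cvg_lim => //; apply: measure_semi_sigma_additive.
  - by move=> n; exact: measurable_xsection.
  - exact: trivIset_xsection.
  - by apply: bigcup_measurable => n _; exact: measurable_xsection.
apply/cvg_closeP; split.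
  by apply: is_cvg_nneseries => n _ _; exact: integral_ge0.
rewrite closeE// integral_nneseries// => n.
exact: measurable_release.
Qed.

HB.instance Definition _ := isMeasure.Build _ _ _ release_law
  release_law0 release_law_ge0 release_law_sigma_additive.

Let release_law_setT : release_law setT = 1.
Proof.
rewrite /release_law; under eq_integral do rewrite xsectionE preimage_setT prob_kernel.
rewrite integral_cst// mul1e.
exact: (@probability_setT _ _ _ (L \x P : probability _ R)).
Qed.

HB.instance Definition _ := Measure_isProbability.Build _ _ _ release_law
  release_law_setT.

End step.

(* The law of (Z_1, ..., Z_n) when the raw data are i.i.d. with law P: the n-th raw
   datum is independent of (Z_1, ..., Z_(n-1)), which is a function of the earlier
   raw data and of the randomness of the first n - 1 kernels. *)
Fixpoint private_law (P : probability T R) d (H : measurableType d) n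
    (Q : mechanism H n) : probability H R :=
  match Q with
  | no_release => \d_tt
  | release _ _ _ _ _ Q' k => release_law (private_law P Q') P k
  end.

End mechanisms.

Section minimax.
Context {R : realType}.
Variables (d : nat) (beta C M : R).
Local Open Scope ereal_scope.

(* Only the values mt z x for x in [0,1]^d matter; joint measurability in (z, x) is
   what makes the integrated squared error a measurable function of z. *)
Definition estimator dH (H : measurableType dH) : set (H -> d.-tuple R -> R) :=
  [set mt | measurable_fun (setT `*` cube d) (fun w : H * d.-tuple R => mt w.1 w.2)].

Definition risk dH (H : measurableType dH) n
    (Q : mechanism (d.-tuple R * R)%type H n) (mt : H -> d.-tuple R -> R)
    (m : {mfun d.-tuple R >-> R}) : \bar R :=
  \int[private_law (raw_law m) Q]_z
    \int[lebesgue_tuple d]_(x in cube d) ((mt z x - m x) ^+ 2)%:E.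

Definition minimax_risk (alpha : \bar R) (n : nat) : \bar R :=
  ereal_inf [set r | exists dH (H : measurableType dH)
      (Q : mechanism (d.-tuple R * R)%type H n) (mt : H -> d.-tuple R -> R),
    [/\ locally_private alpha (potential_raw beta C M) Q, estimator mt &
        r = ereal_sup [set risk Q mt m | m in regression_class beta C M]]].

(* Equals min ((n (e^alpha - 1)^2)^(- beta / (beta + d)), 1); the power is written as
   an inverse in \bar R so that it is +oo for alpha = 0 (`^ is 0 at a zero base
   with a negative exponent) and 0 for alpha = +oo. *)
Definition private_rate (alpha : \bar R) (n : nat) : \bar R :=
  mine ((n%:R%:E * (expeR alpha - 1) ^+ 2) `^ (beta / (beta + d%:R)))^-1 1.

Hypotheses (beta_gt0 : (0 < beta)%R) (n : nat) (n_gt0 : (0 < n)%N).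

Let expo_gt0 : (0 < beta / (beta + d%:R))%R.
Proof. by rewrite divr_gt0// ltr_pwDl. Qed.

Lemma private_rate0 : private_rate 0 n = 1.
Proof.
rewrite /private_rate expeR0 subee// /expe/= !mulr0 powR0 ?gt_eqF//.
by rewrite inve0 minEle leNgt ltey.
Qed.

Lemma private_ratey : private_rate +oo n = 0.
Proof.
rewrite /private_rate /= addye// /expe/= mulyy gt0_muley ?lte_fin ?ltr0n//.
by rewrite poweRyr ?gt_eqF// invey minEle lee01.
Qed.

Lemma private_rateE (a : R) : (0 < a)%R -> private_rate a%:E n =
  (Num.min ((n%:R * (expR a - 1) ^+ 2) `^ (- (beta / (beta + d%:R)))) 1)%:E.
Proof.
move=> a0; rewrite /private_rate /= inver.
have -> : ((n%:R * (expR a - 1) ^+ 2) `^ (beta / (beta + d%:R)) == 0)%R = false.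
  apply/gt_eqF; rewrite powR_gt0// mulr_gt0 ?ltr0n// exprn_gt0//.
  by rewrite subr_gt0 expR_gt1.
by rewrite powRN EFin_min.
Qed.

End minimax.

(* Main.v *)
From HB Require Import structures.
From mathcomp Require Import all_boot all_order all_algebra.
From mathcomp Require Import all_classical all_reals all_analysis.
From mathcomp Require Import measurable_realfun.
From mathcomp Require Import ring lra.
Require Import Defs.

Set Implicit Arguments.
Unset Strict Implicit.
Unset Printing Implicit Defensive.

Import Order.TTheory GRing.Theory Num.Theory.
Import numFieldNormedType.Exports.

Local Open Scope classical_set_scope.
Local Open Scope ring_scope.

(** Cut [0,1]^d into N^d cells of side 1/N and put in each cell a bump of height
   of order N^-beta and of Hoelder exponent beta. Switching every bump on or off
   gives a family of regression functions indexed by the vertices of a cube.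
   An estimator whose squared error is small on most cells must detect, on most
   cells, whether the bump is there, so it suffices to show that the private
   laws of two functions differing by one bump are hard to tell apart
   ([two_point_loss]), and to average over cells and vertices ([assouad]).

   Toggling one bump moves the law of a raw datum by at most
   t <= c N^-(beta+d) in total variation, because adding a shift to uniform
   noise costs at most the size of the shift ([raw_law_close]). Privacy shrinks
   this: as a function of the raw datum, the chance of any event of the next
   release varies by a factor of at most e^alpha, so the conditional laws of the
   next release under the two models differ, event by event, by at most
   delta = (e^alpha - 1) t times the probability of the event
   ([release_dirac_close]).

   Such a multiplicative closeness would bound the chi-square divergence of one
   step by delta^2, and chi-square divergences of successive steps multiply as
   (1 + delta^2)^n. Densities with respect to the history are avoided by working
   with the dual form of that bound: (E f)^2 <= (1 + delta^2)^n E' (f^2) for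
   every f with values in [0,1]. One step is [sqr_Rintegral_le], and the
   induction over the releases is [second_moment_private_law].

   Finally N is taken as small as n delta^2 <= 1/4 allows, up to a factor 2: for
   finite alpha, N^(2(beta+d)) is of order max(n (e^alpha - 1)^2, 1)
   ([grid_size], [cell_budget]). The loss is then of order N^d cells times N^-d (volume) times
   N^(-2 beta) (squared height), which is the announced rate. *)

(** * Test functions and the dual second-moment bound *)

Section test_functions.
Context {d} {T : measurableType d} {R : realType}.
Implicit Types (f g : T -> R) (P : probability T R).

Definition bounded_measurable f :=
  measurable_fun setT f /\ exists c, forall x, `|f x| <= c.

Definition is_test f := measurable_fun setT f /\ forall x, 0 <= f x <= 1.

Lemma measurable_EFin_test f : is_test f -> measurable_fun setT (EFin \o f).
Proof. by move=> [mf _]; exact/measurable_EFinP. Qed.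

Lemma EFin_test_ge0 f x : is_test f -> (0 <= (EFin \o f) x)%E.
Proof. by move=> [_ /(_ x) /andP[? _]]; rewrite lee_fin. Qed.

Lemma test_bounded f : is_test f -> bounded_measurable f.
Proof.
by move=> [mf f01]; split=> //; exists 1 => x; have /andP[? ?] := f01 x; rewrite ger0_norm.
Qed.

Lemma bounded_cst c : bounded_measurable (fun=> c).
Proof. by split; [exact: measurable_cst|exists `|c| => x]. Qed.

Lemma bounded_add f g : bounded_measurable f -> bounded_measurable g ->
  bounded_measurable (fun x => f x + g x).
Proof.
move=> [mf [a fa]] [mg [b gb]]; split; first exact: measurable_funD.
by exists (a + b) => x; rewrite (le_trans (ler_normD _ _))// lerD.
Qed.

Lemma bounded_mul f g : bounded_measurable f -> bounded_measurable g ->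
  bounded_measurable (fun x => f x * g x).
Proof.
move=> [mf [a fa]] [mg [b gb]]; split; first exact: measurable_funM.
by exists (a * b) => x; rewrite normrM ler_pM.
Qed.

Lemma bounded_integrable P f : bounded_measurable f ->
  P.-integrable setT (EFin \o f).
Proof.
move=> [mf [c fc]]; apply: measurable_bounded_integrable => //.
  by rewrite [X in (X < _)%E](probability_setT P) ltry.
exists c; split; first by rewrite num_real.
by move=> y cy x _ /=; rewrite (le_trans (fc x))// ltW.
Qed.

Lemma EFin_Rintegral P f : bounded_measurable f ->
  (\int[P]_x f x)%:E = (\int[P]_x (f x)%:E)%E.
Proof.
move=> bf; rewrite /Rintegral fineK//.
exact: (integrable_fin_num _ (bounded_integrable P bf)).
Qed.

Lemma RintegralD_bounded P f g : bounded_measurable f -> bounded_measurable g ->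
  \int[P]_x (f x + g x) = \int[P]_x f x + \int[P]_x g x.
Proof. by move=> bf bg; rewrite RintegralD//; exact: bounded_integrable. Qed.

Lemma RintegralZ_bounded P k f : bounded_measurable f ->
  \int[P]_x (k * f x) = k * \int[P]_x f x.
Proof. by move=> bf; rewrite RintegralZl//; exact: bounded_integrable. Qed.

Lemma Rintegral_cst_prob P c : \int[P]_x c = c.
Proof. by rewrite Rintegral_cst//= probability_setT mulr1. Qed.

Lemma le_Rintegral_bounded P f g : bounded_measurable f -> bounded_measurable g ->
  (forall x, f x <= g x) -> \int[P]_x f x <= \int[P]_x g x.
Proof. by move=> bf bg fg; apply: le_Rintegral => //; exact: bounded_integrable. Qed.

Lemma Rintegral_test P f : is_test f -> 0 <= \int[P]_x f x <= 1.
Proof.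
move=> tf; apply/andP; split.
  by apply: Rintegral_ge0 => x _; case: tf => _ /(_ x)/andP[].
rewrite -[leRHS](Rintegral_cst_prob P); apply: le_Rintegral_bounded.
- exact: test_bounded.
- exact: bounded_cst.
- by move=> x; case: tf => _ /(_ x)/andP[].
Qed.

Lemma test_sqr f : is_test f -> is_test (fun x => f x ^+ 2).
Proof.
move=> [mf f01]; split; first exact: measurable_funX.
by move=> x; have := f01 x; nra.
Qed.

(** The dual form of a chi-square bound. With c the mean of f under mu', the
   hypothesis applied to the positive and negative parts of f - c gives
   E f - c <= dl E' |f - c|; since E' |f - c| is at most the standard deviation
   s of f under mu', the claim is Cauchy-Schwarz:
   (c + dl s)^2 <= (1 + dl^2) (c^2 + s^2). *)
Lemma sqr_Rintegral_le (mu mu' : probability T R) (dl : R) f :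
    0 <= dl -> is_test f ->
    (forall g, is_test g -> `|\int[mu]_x g x - \int[mu']_x g x| <= dl * \int[mu']_x g x) ->
  (\int[mu]_x f x) ^+ 2 <= (1 + dl ^+ 2) * \int[mu']_x (f x ^+ 2).
Proof.
move=> dl0 tf close.
have [mf f01] := tf; have bf := test_bounded tf.
have /andP[E0 _] := Rintegral_test mu tf.
have /andP[c0 c1] := Rintegral_test mu' tf.
set c := \int[mu']_x f x in c0 c1 *.
pose u x := Num.max (f x - c) 0; pose w x := Num.max (c - f x) 0.
have tu : is_test u.
  split; first by apply: measurable_maxr => //; exact: measurable_funB.
  by move=> x; rewrite /u; have := f01 x; rewrite le_max lexx orbT ge_max; lra.
have tw : is_test w.
  split; first by apply: measurable_maxr => //; exact: measurable_funB.
  by move=> x; rewrite /w; have := f01 x; rewrite le_max lexx orbT ge_max; lra.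
have uwE x : u x = w x + (f x + - c) by rewrite /u /w !maxEle; do 2 case: ifP; lra.
have bu := test_bounded tu; have bw := test_bounded tw.
have bfc := bounded_add bf (bounded_cst (- c)).
have intE P : \int[P]_x u x = \int[P]_x w x + (\int[P]_x f x - c).
  rewrite (@eq_Rintegral _ _ _ P setT (fun x => w x + (f x + - c)) u); last first.
    by move=> x _; rewrite uwE.
  by rewrite !RintegralD_bounded ?Rintegral_cst_prob//; exact: bounded_cst.
have := intE mu; have := intE mu'; rewrite -/c subrr addr0.
have := close _ tu; have := close _ tw.
have /andP[] := Rintegral_test mu' tu; have /andP[] := Rintegral_test mu' tw.
set a := \int[mu]_x f x in E0 *.
move: (\int[mu]_x u x) (\int[mu]_x w x) => U W.
(* Here s = E' |f - c|, and (E' |f - c|)^2 <= E' (f - c)^2 is obtained by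
   integrating the tangent bound (u + w)^2 >= 2 s (u + w) - s^2. *)
have : c ^+ 2 + (\int[mu']_x u x + \int[mu']_x w x) ^+ 2 <= \int[mu']_x (f x ^+ 2).
  set s := \int[mu']_x u x + \int[mu']_x w x.
  have bs := bounded_mul (bounded_cst (2 * s)) (bounded_add bu bw).
  have bm := bounded_mul (bounded_cst (2 * c)) bfc.
  have bk := bounded_cst (c ^+ 2 - s ^+ 2).
  have -> : c ^+ 2 + s ^+ 2 = \int[mu']_x
      ((2 * s) * (u x + w x) + ((2 * c) * (f x + - c) + (c ^+ 2 - s ^+ 2))).
    rewrite RintegralD_bounded//; last exact: bounded_add.
    rewrite RintegralD_bounded//.
    rewrite RintegralZ_bounded; last exact: bounded_add.
    rewrite RintegralZ_bounded// Rintegral_cst_prob !RintegralD_bounded//; last exact: bounded_cst.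
    by rewrite Rintegral_cst_prob -/c -/s; ring.
  apply: le_Rintegral_bounded.
  - by apply: bounded_add => //; exact: bounded_add.
  - exact/test_bounded/test_sqr.
  - move=> x; have : (u x + w x) ^+ 2 = (f x - c) ^+ 2.
      by rewrite /u /w !maxEle; do 2 case: ifP; nra.
    by have := sqr_ge0 (u x + w x - s); nra.
move: (\int[mu']_x u x) (\int[mu']_x w x) (\int[mu']_x (f x ^+ 2)) => U' W' F.
move=> HF W0 _ U0 _ HW HU E1 E2.
have aE : a <= c + dl * (U' + W').
  by move: HW HU; rewrite !ler_norml => /andP[? ?] /andP[? ?]; lra.
set s := U' + W' in HF aE.
have s0 : 0 <= s by rewrite addr_ge0.
have : a ^+ 2 <= (c + dl * s) ^+ 2 by rewrite ler_sqr ?nnegrE// addr_ge0// mulr_ge0.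
have : (1 + dl ^+ 2) * (c ^+ 2 + s ^+ 2) <= (1 + dl ^+ 2) * F.
  by rewrite ler_wpM2l// addr_ge0// sqr_ge0.
have := sqr_ge0 (dl * c - s); nra.
Qed.

End test_functions.

(** * Integrating against one release *)

Section release_integral.
Context {R : realType} {dT} {T : measurableType dT}.
Context {d} {H : measurableType d} {d'} {Z : measurableType d'}.
Variables (P : probability T R) (k : R.-pker (H * T)%type ~> Z).
Local Open Scope ereal_scope.

Lemma measurable_pair_history (u : unit * (H * T)) :
  measurable_fun setT (fun z : Z => (u.2.1, z)).
Proof. exact: measurable_fun_pair. Qed.

(** The kernel that keeps the history next to the freshly released datum: with
   it, [release_law] becomes a composition of kernels, whose integrals are
   iterated integrals. The dummy [unit] is the source of the constant kernel
   that draws the history and the raw datum. *)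
Definition graph_kernel (u : unit * (H * T)) : {measure set (H * Z) -> \bar R} :=
  measure_function_pushforward__canonical__measure_function_Measure
    (k u.2) (measurable_pair_history u).

Lemma graph_kernelE u A : graph_kernel u A = k u.2 (xsection A u.2.1).
Proof. by rewrite /graph_kernel /= /pushforward xsectionE. Qed.

Let measurable_graph_kernel A : measurable A ->
  measurable_fun setT (graph_kernel ^~ A).
Proof.
move=> mA; under eq_fun do rewrite graph_kernelE.
exact: (measurableT_comp (measurable_release k mA) measurable_snd).
Qed.

HB.instance Definition _ := isKernel.Build _ _ _ _ R graph_kernel
  measurable_graph_kernel.

Let graph_kernel_prob u : graph_kernel u setT = 1.
Proof. by rewrite graph_kernelE xsectionE preimage_setT prob_kernel. Qed.

HB.instance Definition _ := Kernel_isProbability.Build _ _ _ _ R graph_kernel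
  graph_kernel_prob.

Definition release_mean (psi : H * Z -> \bar R) (w : H * T) :=
  \int[k w]_z psi (w.1, z).

Lemma measurable_release_mean psi : measurable_fun setT psi ->
  (forall x, 0 <= psi x) -> measurable_fun setT (release_mean psi).
Proof.
move=> mpsi psi0.
apply: (@measurable_kfcomp _ _ (H * T)%type Z R k (fun x => psi (x.1.1, x.2))) => //.
apply: (measurableT_comp mpsi); apply: measurable_fun_pair => //.
exact: measurableT_comp.
Qed.

Lemma release_mean_ge0 psi w : (forall x, 0 <= psi x) -> 0 <= release_mean psi w.
Proof. by move=> psi0; exact: integral_ge0. Qed.

Lemma ge0_integral_release (L : probability H R) psi :
  measurable_fun setT psi -> (forall x, 0 <= psi x) ->
  \int[release_law L P k]_x psi x = \int[L]_h \int[P]_v release_mean psi (h, v).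
Proof.
move=> mpsi psi0.
pose l : R.-pker unit ~> (H * T)%type :=
  kprobability (@measurable_cst _ _ _ _ setT ((L \x P) : pprobability _ R)).
transitivity (\int[kcomp l graph_kernel tt]_x psi x).
  apply: eq_measure_integral => A mA _.
  rewrite /= /release_law /kcomp; apply: eq_integral => w _.
  by rewrite graph_kernelE.
rewrite integral_kcomp//.
transitivity (\int[L \x P]_w release_mean psi w).
  apply: eq_integral => w _; rewrite ge0_integral_pushforward//.
  exact: measurable_pair_history.
apply: (@fubini_tonelli1 _ _ _ _ R L P (release_mean psi)).
- exact: measurable_release_mean.
- by move=> w; exact: release_mean_ge0.
Qed.

(** Starting from a Dirac mass at h isolates the conditional law of the next
   release given the history h, averaged over the raw datum. *)
Lemma ge0_integral_release_dirac h psi :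
  measurable_fun setT psi -> (forall x, 0 <= psi x) ->
  \int[release_law \d_h P k]_x psi x = \int[P]_v release_mean psi (h, v).
Proof.
move=> mpsi psi0; rewrite ge0_integral_release// integral_dirac//.
  by rewrite diracE in_setT mul1e.
apply: measurable_fun_fubini_tonelli_F.
- exact: measurable_release_mean.
- by move=> w; exact: release_mean_ge0.
Qed.

Lemma measurable_integral_release_dirac psi :
  measurable_fun setT psi -> (forall x, 0 <= psi x) ->
  measurable_fun setT (fun h => \int[release_law \d_h P k]_x psi x).
Proof.
move=> mpsi psi0; under eq_fun do rewrite ge0_integral_release_dirac//.
apply: (@measurable_fun_fubini_tonelli_F _ _ _ _ _ P (release_mean psi)).
- exact: measurable_release_mean.
- by move=> w; exact: release_mean_ge0.
Qed.

Lemma ge0_integral_release_mix (L : probability H R) psi :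
  measurable_fun setT psi -> (forall x, 0 <= psi x) ->
  \int[release_law L P k]_x psi x =
  \int[L]_h \int[release_law \d_h P k]_x psi x.
Proof.
move=> mpsi psi0; rewrite ge0_integral_release//.
by apply: eq_integral => h _; rewrite ge0_integral_release_dirac.
Qed.

End release_integral.

(** * Privacy makes the laws of the releases close *)

Section ratio.
Context {R : realType} {d} {Z : measurableType d}.
Local Open Scope ereal_scope.

Lemma integral_ratio_le (mu nu : {measure set Z -> \bar R}) (a : R)
    (g : Z -> \bar R) :
    fin_num_fun mu -> fin_num_fun nu ->
    measurable_fun setT g -> (forall z, 0 <= g z) ->
    (forall A, measurable A -> mu A / nu A <= expeR a%:E) ->
  \int[mu]_z g z <= (expR a)%:E * \int[nu]_z g z.
Proof.
move=> mufin nufin mg g0 munu.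
have e0 : (0 <= expR a)%R by exact: expR_ge0.
rewrite -(@ge0_integral_mscale _ _ _ nu setT measurableT (NngNum e0))//.
apply: ge0_le_measure_integral => // A mA; rewrite /mscale/=.
suff : mu A <= (expR a)%:E * nu A by [].
have := munu A mA.
have : (0 <= fine (mu A))%R by exact: fine_ge0.
have : (0 <= fine (nu A))%R by exact: fine_ge0.
rewrite -(fineK (mufin A mA)) -(fineK (nufin A mA)) inver /=.
move: (fine (mu A)) (fine (nu A)) => x y y0 x0.
(* If nu A = 0 the ratio is +oo, which is excluded, unless mu A = 0 as well. *)
case: ifPn => [/eqP->|yn0]; last by rewrite -!EFinM !lee_fin ler_pdivrMr ?lt0r ?yn0.
have [->|xn0] := eqVneq x 0%R; first by rewrite mule0.
by rewrite gt0_muley// lte_fin lt0r xn0.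
Qed.

End ratio.

Section release_contraction.
Context {R : realType} {dT} {T : measurableType dT}.
Variables (P P' : probability T R) (V : set T) (t : R).

(** A total variation bound t between P and P' that only looks at values on V,
   the set where privacy constrains the kernels: the integrals of F differ by at
   most t times the oscillation D of F on V. *)
Definition close_on := forall (F : T -> R) (I D : R), is_test F -> 0 <= I -> 0 <= D ->
  (forall v, V v -> I <= F v <= I + D) ->
  `|\int[P]_v F v - \int[P']_v F v| <= D * t.

(** P' gives no mass outside V, in the form in which it is used. *)
Definition carried_by := forall (F : T -> R) (I : R), is_test F -> 0 <= I ->
  (forall v, V v -> I <= F v) -> I <= \int[P']_v F v.

Hypotheses (t_ge0 : 0 <= t) (PP' : close_on) (P'V : carried_by).

Section one_step.
Context {d} {H : measurableType d} {d'} {Z : measurableType d'}.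
Variable k : R.-pker (H * T)%type ~> Z.

Lemma kernel_fin_num_fun w : fin_num_fun (k w).
Proof.
move=> A mA; rewrite ge0_fin_numE//; apply: (@le_lt_trans _ _ (k w setT)).
  by rewrite le_measure// inE.
by rewrite prob_kernel ltry.
Qed.

Definition Rrelease_mean (g : H * Z -> R) (w : H * T) : R :=
  fine (release_mean k (EFin \o g) w).

Lemma release_mean_test_bounds g w : is_test g ->
  (0 <= release_mean k (EFin \o g) w <= 1)%E.
Proof.
move=> tg; apply/andP; split.
  by apply: release_mean_ge0 => x; exact: EFin_test_ge0.
apply: (@le_trans _ _ (\int[k w]_z (cst 1%E z))%E).
  apply: ge0_le_integral => //.
  - by move=> z _; exact: (EFin_test_ge0 (f := g)).
  - exact: (measurableT_comp (measurable_EFin_test tg)).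
  - by move=> z _ /=; rewrite lee_fin; case: tg => _ /(_ (w.1, z))/andP[].
by rewrite integral_cst// prob_kernel mule1.
Qed.

Lemma EFin_Rrelease_mean g w : is_test g ->
  (Rrelease_mean g w)%:E = release_mean k (EFin \o g) w.
Proof.
move=> tg; have /andP[g0 g1] := release_mean_test_bounds w tg.
by rewrite /Rrelease_mean fineK// ge0_fin_numE// (le_lt_trans g1)// ltry.
Qed.

Lemma Rrelease_mean_test g : is_test g -> is_test (Rrelease_mean g).
Proof.
move=> tg; split.
  apply: measurableT_comp => //; apply: measurable_release_mean.
    exact: measurable_EFin_test.
  by move=> x; exact: EFin_test_ge0.
by move=> w; rewrite -!lee_fin EFin_Rrelease_mean//; exact: release_mean_test_bounds.
Qed.

Lemma slice_test (g : H * T -> R) h : is_test g -> is_test (fun v => g (h, v)).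
Proof. by move=> [mg g01]; split; [exact: measurableT_comp|move=> v; exact: g01]. Qed.

Lemma Rintegral_release_dirac (P0 : probability T R) g h : is_test g ->
  \int[release_law \d_h P0 k]_x g x = \int[P0]_v Rrelease_mean g (h, v).
Proof.
move=> tg; rewrite /Rintegral; congr fine.
rewrite (@ge0_integral_release_dirac _ _ _ _ _ _ _ P0 k h (EFin \o g))//.
- by apply: eq_integral => v _; rewrite EFin_Rrelease_mean.
- exact: measurable_EFin_test.
- by move=> x; exact: EFin_test_ge0.
Qed.

Lemma Rintegral_release_dirac_test (P0 : probability T R) g : is_test g ->
  is_test (fun h => \int[release_law \d_h P0 k]_x g x).
Proof.
move=> tg; split; last by move=> h; exact: Rintegral_test.
apply: measurableT_comp => //.
apply: (@measurable_integral_release_dirac _ _ _ _ _ _ _ P0 k (EFin \o g)).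
- exact: measurable_EFin_test.
- by move=> x; exact: EFin_test_ge0.
Qed.

Lemma Rintegral_release_mix (P0 : probability T R) (L : probability H R) g : is_test g ->
  \int[release_law L P0 k]_x g x =
  \int[L]_h \int[release_law \d_h P0 k]_x g x.
Proof.
move=> tg; rewrite {1 2}/Rintegral; congr fine.
rewrite (@ge0_integral_release_mix _ _ _ _ _ _ _ P0 k L (EFin \o g))//.
- apply: eq_integral => h _ /=; rewrite EFin_Rintegral//; exact: test_bounded.
- exact: measurable_EFin_test.
- by move=> x; exact: EFin_test_ge0.
Qed.

Variables (a : R) (v0 : T).
Hypotheses (a_ge0 : 0 <= a) (Vv0 : V v0).
Hypothesis kP : forall (A : set Z) (h : H) (v v' : T), measurable A ->
  V v -> V v' -> (k (h, v) A / k (h, v') A <= expeR a%:E)%E.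

Let dl := (expR a - 1) * t.

Let dl_ge0 : 0 <= dl.
Proof. by rewrite mulr_ge0// subr_ge0 -expR0 ler_expR. Qed.

(** The mean F of g under the kernel, as a function of the raw datum, has
   I <= F <= e^a I on V with I its infimum there. Its oscillation is thus at most
   (e^a - 1) I, and I is at most the mean of F under P'. *)
Lemma release_dirac_close (g : H * Z -> R) h : is_test g ->
  `|\int[release_law \d_h P k]_x g x - \int[release_law \d_h P' k]_x g x|
    <= dl * \int[release_law \d_h P' k]_x g x.
Proof.
move=> tg; rewrite !Rintegral_release_dirac//.
set F := fun v => Rrelease_mean g (h, v).
have tF : is_test F by exact/slice_test/Rrelease_mean_test.
have F01 v : 0 <= F v <= 1 by case: tF.
have Fratio v v' : V v -> V v' -> F v <= expR a * F v'.
  move=> Vv Vv'; rewrite -lee_fin EFinM !EFin_Rrelease_mean//.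
  apply: integral_ratio_le.
  - exact: kernel_fin_num_fun.
  - exact: kernel_fin_num_fun.
  - exact: (measurableT_comp (measurable_EFin_test tg)).
  - by move=> z; exact: (EFin_test_ge0 (f := g)).
  - by move=> A mA; exact: kP.
pose I := inf (F @` V).
have hI : has_inf (F @` V).
  by split; [exists (F v0), v0|exists 0 => _ [v _ <-]; have /andP[] := F01 v].
have IF v : V v -> I <= F v by move=> Vv; apply: ge_inf; [case: hI|exists v].
have I0 : 0 <= I by apply: lb_le_inf; [case: hI|move=> _ [v _ <-]; have /andP[] := F01 v].
have FI v : V v -> F v <= expR a * I.
  move=> Vv; rewrite -ler_pdivrMl ?expR_gt0//.
  apply: lb_le_inf; first by case: hI.
  by move=> _ [v' Vv' <-]; rewrite ler_pdivrMl ?expR_gt0//; exact: Fratio.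
apply: (@le_trans _ _ (((expR a - 1) * I) * t)).
  apply: (PP' (I := I)) => //.
    by rewrite mulr_ge0// subr_ge0 -expR0 ler_expR.
  by move=> v Vv; rewrite IF// mulrBl mul1r addrC subrK FI.
rewrite mulrAC; apply: ler_wpM2l => //.
exact: P'V.
Qed.

(** Given the history h, the mean S h of f under P obeys the one-step bound, and
   S is again a test function, to which the bound on histories applies. *)
Lemma second_moment_release (B : R) (L L' : probability H R) : 0 <= B ->
  (forall f, is_test f -> (\int[L]_h f h) ^+ 2 <= B * \int[L']_h (f h ^+ 2)) ->
  forall f, is_test f -> (\int[release_law L P k]_x f x) ^+ 2 <=
    (B * (1 + dl ^+ 2)) * \int[release_law L' P' k]_x (f x ^+ 2).
Proof.
move=> B0 LL' f tf; have tf2 := test_sqr tf.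
rewrite (Rintegral_release_mix P L tf) (Rintegral_release_mix P' L' tf2).
have tS := Rintegral_release_dirac_test P tf.
have tS' := Rintegral_release_dirac_test P' tf2.
apply: le_trans (LL' _ tS) _; rewrite -mulrA; apply: ler_wpM2l => //.
rewrite -RintegralZ_bounded; last exact: test_bounded.
apply: le_Rintegral_bounded.
- exact/test_bounded/test_sqr.
- exact: (bounded_mul (bounded_cst _) (test_bounded tS')).
- move=> h; apply: sqr_Rintegral_le => // g tg; exact: release_dirac_close.
Qed.

End one_step.

(** The constants of the successive releases multiply, as chi-square divergences
   do for adaptively chosen experiments. *)
Lemma second_moment_private_law (a : R) (v0 : T) : 0 <= a -> V v0 ->
  forall d (H : measurableType d) n (Q : mechanism T H n),
  locally_private a%:E V Q -> forall f, is_test f ->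
  (\int[private_law P Q]_x f x) ^+ 2 <=
    (1 + ((expR a - 1) * t) ^+ 2) ^+ n * \int[private_law P' Q]_x (f x ^+ 2).
Proof.
move=> a0 Vv0 d H n Q; elim: Q => [|{}d {}H {}n d' Z Q IH k] /=.
  move=> _ f tf; rewrite expr0 mul1r /Rintegral.
  by rewrite !integral_dirac ?diracE ?in_setT ?mul1e.
move=> [/IH {}IH kP] f tf; rewrite [_ ^+ n.+1]exprSr.
have B0 : 0 <= (1 + ((expR a - 1) * t) ^+ 2) ^+ n by rewrite exprn_ge0// addr_ge0// sqr_ge0.
exact: (second_moment_release a0 Vv0 kP B0 IH tf).
Qed.

End release_contraction.

(** * Total variation between raw data *)

Section raw_law_distance.
Context {R : realType}.
Local Notation leb := (@lebesgue_measure R).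
Local Notation MR := (measurableTypeR R).

(** The values of a + eta for eta in [-1/2, 1/2]. *)
Definition window (a : R) : set MR := `[a - 2^-1, a + 2^-1]%classic.

Lemma measurable_window a : measurable (window a).
Proof. exact: measurable_itv. Qed.

Local Open Scope ereal_scope.

Lemma lebesgue_window a : leb (window a) = 1.
Proof.
rewrite /window lebesgue_measure_itv/= lte_fin.
have -> : (a - 2^-1 < a + 2^-1)%R by lra.
by rewrite -EFinB; congr EFin; lra.
Qed.

Lemma lebesgue_shift (a : R) (A : set MR) : measurable A ->
  leb ((fun y : MR => a + y : MR)%R @^-1` A) = leb A.
Proof.
move=> mA.
have ms : measurable_fun setT (fun y : MR => a + y : MR)%R.
  exact: measurable_funD.
have := @lebesgue_measure_unique R
  (measure_function_pushforward__canonical__measure_function_Measure leb ms).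
move=> /(_ _ _ mA) /= ->//.
move=> _ [[x y] _ <-] /=; rewrite /pushforward.
rewrite (_ : _ @^-1` _ = `]x - a, y - a]%classic)%R.
  by rewrite !lebesgue_measure_itv/= !lte_fin ltrD2r -!EFinB; case: ifP => // _; congr EFin; lra.
by apply/seteqP; split => z /=; rewrite !in_itv/= => /andP[? ?]; apply/andP; split; lra.
Qed.

Lemma integral_noise_shift (a : R) (f : MR -> \bar R) :
  measurable_fun setT f -> (forall y, 0 <= f y) ->
  \int[noise]_e f (a + e)%R = \int[leb]_(y in window a) f y.
Proof.
move=> mf f0.
have ms : measurable_fun setT (fun y : MR => a + y : MR)%R.
  exact: measurable_funD.
rewrite /noise integral_uniform//; last exact: (measurableT_comp mf ms).
rewrite (_ : (2^-1 - - 2^-1)%R = 1%R); last by lra.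
rewrite invr1 mul1e.
rewrite (_ : `[_, _]%classic = (fun y : MR => a + y : MR)%R @^-1` window a); last first.
  by rewrite /window; apply/seteqP; split => z /=; rewrite !in_itv/= => /andP[? ?]; apply/andP; split; lra.
rewrite -(@ge0_integral_pushforward _ _ _ _ _ _ ms leb (window a) f)//.
- apply: eq_measure_integral => A mA _; exact: lebesgue_shift.
- exact: measurable_window.
- exact: measurable_funTS.
Qed.

Lemma measurable_windowI (a b : R) : measurable (window a `&` window b).
Proof. by apply: measurableI; exact: measurable_window. Qed.

Lemma measurable_windowD (a b : R) : measurable (window a `\` window b).
Proof. by apply: measurableD; exact: measurable_window. Qed.

(** Both windows have measure 1, so removing the common part leaves the same. *)
Lemma lebesgue_windowDC (a b : R) :
  leb (window a `\` window b) = leb (window b `\` window a).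
Proof.
have /= Ha := @measureDI _ _ _ leb _ _ (measurable_window a) (measurable_window b).
have /= Hb := @measureDI _ _ _ leb _ _ (measurable_window b) (measurable_window a).
move: Ha Hb; rewrite !lebesgue_window setIC => Ha.
have Ifin : leb (window b `&` window a) \is a fin_num.
  rewrite ge0_fin_numE// (@le_lt_trans _ _ 1)// ?ltry//.
  by rewrite -(lebesgue_window b) le_measure// ?inE//; [exact: measurable_windowI|exact: measurable_window].
by rewrite Ha => Hb; rewrite -[LHS](addeK _ Ifin) Hb addeK.
Qed.

Lemma lebesgue_windowD (a b : R) :
  leb (window a `\` window b) <= `|a - b|%:E.
Proof.
wlog ab : a b / (a <= b)%R => [hw|].
  have [|/ltW ba] := leP a b; first exact: hw.
  by rewrite lebesgue_windowDC distrC; exact: hw.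
apply: (@le_trans _ _ (leb `[a - 2^-1, b - 2^-1]%classic)%R).
  rewrite le_measure// ?inE; [exact: measurable_windowD|exact: measurable_itv|].
  move=> x []; rewrite /window/= !in_itv/= => /andP[ax xa] /negP; rewrite negb_and -!ltNge.
  by move=> /orP[?|?]; apply/andP; split; lra.
rewrite lebesgue_measure_itv/= lte_fin; case: ifP => // _.
rewrite -EFinB lee_fin distrC ger0_norm; lra.
Qed.

(** On the common part of the two windows the integrals agree; what is left on
   each side has the same mass, at most |a - b|, and f varies there by at most D. *)
Lemma integral_window_le (f : MR -> R) (a b I D : R) :
  measurable_fun setT f -> (0 <= I)%R -> (0 <= D)%R ->
  (forall y, (window a `|` window b) y -> (I <= f y <= I + D)%R) ->
  \int[leb]_(y in window a) (f y)%:E <=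
  \int[leb]_(y in window b) (f y)%:E + (D * `|a - b|)%:E.
Proof.
move=> mf I0 D0 fID.
have mF : measurable_fun setT (EFin \o f) by exact/measurable_EFinP.
have f0 y : (window a `|` window b) y -> 0 <= (EFin \o f) y.
  by move=> /fID /andP[If _]; rewrite lee_fin (le_trans I0).
have split_window c e : (forall y, window c y -> 0 <= (EFin \o f) y) ->
    \int[leb]_(y in window c) (f y)%:E =
    \int[leb]_(y in window c `&` window e) (f y)%:E +
    \int[leb]_(y in window c `\` window e) (f y)%:E.
  move=> c0; rewrite -{1}(setUIDK (window c) (window e)) ge0_integral_setU//.
  - exact: measurable_windowI.
  - exact: measurable_windowD.
  - exact: measurable_funTS.
  - by move=> y; rewrite setUIDK; exact: c0.
  - by rewrite disj_set2E setDE setIACA setICr setI0.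
have a0 y : window a y -> 0 <= (EFin \o f) y by move=> ay; apply: f0; left.
have b0 y : window b y -> 0 <= (EFin \o f) y by move=> ay; apply: f0; right.
rewrite (split_window a b a0) (split_window b a b0) setIC -addeA; apply: leeD => //.
have mD := measurable_windowD.
apply: (@le_trans _ _ (\int[leb]_(y in window a `\` window b) (I + D)%:E)).
  apply: ge0_le_integral => //.
  - by move=> y [/a0].
  - exact: measurable_funTS.
  - by move=> y [ay _]; rewrite lee_fin; have /andP[] := fID y (or_introl ay).
apply: (@le_trans _ _ ((I + D)%:E * leb (window a `\` window b))).
  by rewrite integral_cst.
rewrite EFinD ge0_muleDl ?lee_fin//; apply: leeD.
  rewrite lebesgue_windowDC.
  apply: (@le_trans _ _ (\int[leb]_(y in window b `\` window a) I%:E)).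
    by rewrite integral_cst.
  apply: ge0_le_integral => //.
  - exact: measurable_funTS.
  - by move=> y [by_ _]; rewrite lee_fin; have /andP[] := fID y (or_intror by_).
by rewrite EFinM; apply: lee_wpmul2l; rewrite ?lee_fin//; exact: lebesgue_windowD.
Qed.

(** The restricted measure vanishes outside D. *)
Lemma integral_mrestr dX (X : measurableType dX) (mu : {measure set X -> \bar R})
    (D : set X) (mD : measurable D) (f : X -> \bar R) :
  measurable_fun setT f -> (forall x, 0 <= f x) ->
  \int[mrestr mu mD]_x f x = \int[mu]_(x in D) f x.
Proof.
move=> mf f0; have mDc := measurableC mD.
rewrite -(setUv D) ge0_integral_setU//; last 2 first.
- exact: measurable_funTS.
- by rewrite disj_set2E setICr.
rewrite [X in _ + X]null_set_integral//; last 2 first.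
- exact: measurable_funTS.
- by rewrite /= /mrestr setICl measure0.
rewrite adde0; apply: eq_measure_integral => A mA AD.
by rewrite /= /mrestr setIidl.
Qed.

Context {d : nat}.
Local Notation raw := (d.-tuple R * R)%type.

Section one_regression_function.
Variable m : {mfun d.-tuple R >-> R}.

(** Given X = x the response is uniform on the window around m x. Measurability of
   the inner integral comes with the same Tonelli argument. *)
Lemma raw_law_noise (psi : raw -> \bar R) :
  measurable_fun setT psi -> (forall v, 0 <= psi v) ->
  \int[raw_law m]_v psi v =
  \int[lebesgue_tuple d]_(x in cube d) \int[leb]_(y in window (m x)) psi (x, y)
  /\ measurable_fun setT (fun x => \int[leb]_(y in window (m x)) psi (x, y)).
Proof.
move=> mpsi psi0.
have mcomp := measurableT_comp mpsi (measurable_raw_datum m).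
have inner x : \int[noise]_e (psi \o raw_datum m) (x, e) =
    \int[leb]_(y in window (m x)) psi (x, y).
  rewrite -(@integral_noise_shift (m x) (fun y => psi (x, y)))//.
  exact: measurableT_comp.
have mfubini : measurable_fun setT
    (fun x => \int[noise]_e (psi \o raw_datum m) (x, e)).
  by apply: (@measurable_fun_fubini_tonelli_F _ _ _ _ R noise (psi \o raw_datum m)) => // w; exact: psi0.
have minner : measurable_fun setT (fun x => \int[leb]_(y in window (m x)) psi (x, y)).
  rewrite (_ : (fun x => _) = fun x => \int[noise]_e (psi \o raw_datum m) (x, e)).
    exact: mfubini.
  by apply/funext => x; rewrite inner.
split => //.
rewrite (@ge0_integral_distribution _ _ _ _ _ _ (raw_datum m) psi)//.
rewrite (@fubini_tonelli1 _ _ _ _ R (uniform_cube d) noise _ mcomp)//; last first.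
  by move=> w; exact: psi0.
rewrite (@integral_mrestr _ _ _ _ (@measurable_cube R d)).
- by apply: eq_integral => x _; exact: inner.
- exact: mfubini.
- by move=> x; apply: integral_ge0 => e _; exact: psi0.
Qed.

End one_regression_function.

Variables (beta C M : R).
Local Notation V := (potential_raw beta C M).

Lemma window_potential_raw (m : {mfun d.-tuple R >-> R}) x y :
  regression_class beta C M m -> cube d x -> window (m x) y -> V (x, y).
Proof.
move=> mC xc; rewrite /window/= in_itv/= => /andP[h1 h2]; split => //.
by exists m => //=; rewrite ler_norml; apply/andP; split; lra.
Qed.

Lemma raw_law_le (m m' : {mfun d.-tuple R >-> R}) (t : R) (F : raw -> R) (I D : R) :
  regression_class beta C M m -> regression_class beta C M m' ->
  \int[lebesgue_tuple d]_(x in cube d) (`|m x - m' x|)%:E <= t%:E ->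
  is_test F -> (0 <= I)%R -> (0 <= D)%R -> (forall v, V v -> (I <= F v <= I + D)%R) ->
  (\int[raw_law m]_v F v <= \int[raw_law m']_v F v + D * t)%R.
Proof.
move=> mC m'C tE tF I0 D0 FID.
have mF := measurable_EFin_test tF.
have F0 v : 0 <= (EFin \o F) v by exact: EFin_test_ge0.
have bF := test_bounded tF.
have [Em m1] := raw_law_noise m mF F0; have [Em' m2] := raw_law_noise m' mF F0.
have {}Em := etrans (EFin_Rintegral (raw_law m) bF) Em.
have {}Em' := etrans (EFin_Rintegral (raw_law m') bF) Em'.
suff : \int[lebesgue_tuple d]_(x in cube d) \int[leb]_(y in window (m x)) (F (x, y))%:E <=
  \int[lebesgue_tuple d]_(x in cube d) \int[leb]_(y in window (m' x)) (F (x, y))%:E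
  + (D * t)%:E by rewrite -[leLHS]Em -[X in _ <= X + _]Em' -EFinD lee_fin.
clear Em Em'.
have mdist : measurable_fun setT (fun x => `|m x - m' x|%R).
  by apply: measurableT_comp => //; apply: measurable_funB; exact: measurable_funPT.
have mdistE : measurable_fun setT (fun x => (`|m x - m' x|%R)%:E) by exact/measurable_EFinP.
have mdistD : measurable_fun setT (fun x => (D * `|m x - m' x|)%:E).
  by apply/measurable_EFinP; exact: measurable_funM.
apply: (@le_trans _ _ (\int[lebesgue_tuple d]_(x in cube d)
  ((\int[leb]_(y in window (m' x)) (F (x, y))%:E) + (D * `|m x - m' x|)%:E))).
  apply: ge0_le_integral => //.
  - exact: measurable_cube.
  - by move=> x _; apply: integral_ge0 => y _; exact: F0.
  - exact: measurable_funTS.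
  - by apply: measurable_funTS; exact: emeasurable_funD.
  - move=> x xc; apply: (@integral_window_le (fun y => F (x, y)) _ _ I) => //.
      by case: tF => mF' _; exact: (measurableT_comp mF').
    by move=> y [] yw; apply: FID; [exact: (window_potential_raw mC)|exact: (window_potential_raw m'C)].
rewrite ge0_integralD//; last 5 first.
- exact: measurable_cube.
- by move=> x _; apply: integral_ge0 => y _; exact: F0.
- exact: measurable_funTS.
- by move=> x _; rewrite lee_fin mulr_ge0.
- exact: measurable_funTS.
apply: leeD => //.
under eq_integral do rewrite EFinM.
rewrite ge0_integralZl//; last 2 first.
- exact: measurable_cube.
- exact: measurable_funTS.
by rewrite EFinM; apply: lee_wpmul2l => //; rewrite lee_fin.
Qed.

Lemma raw_law_close (m m' : {mfun d.-tuple R >-> R}) (t : R) :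
  regression_class beta C M m -> regression_class beta C M m' ->
  \int[lebesgue_tuple d]_(x in cube d) (`|m x - m' x|)%:E <= t%:E ->
  close_on (raw_law m) (raw_law m') V t.
Proof.
move=> mC m'C tE F I D tF I0 D0 FID.
have tE' : \int[lebesgue_tuple d]_(x in cube d) (`|m' x - m x|)%:E <= t%:E.
  by under eq_integral do rewrite distrC.
have close (a b e : R) : (a <= b + e -> b <= a + e -> `|a - b| <= e)%R.
  by move=> ab ba; rewrite ler_norml; apply/andP; split; lra.
exact: (close _ _ _ (raw_law_le mC m'C tE tF I0 D0 FID)
                    (raw_law_le m'C mC tE' tF I0 D0 FID)).
Qed.

Lemma raw_law_carried (m : {mfun d.-tuple R >-> R}) :
  regression_class beta C M m -> carried_by (raw_law m) V.
Proof.
move=> mC F I tF I0 IF.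
have mF := measurable_EFin_test tF.
have F0 v : 0 <= (EFin \o F) v by exact: EFin_test_ge0.
have [Em mw] := raw_law_noise m mF F0.
have {}Em := etrans (EFin_Rintegral (raw_law m) (test_bounded tF)) Em.
rewrite -lee_fin [leRHS]Em {Em}.
apply: (@le_trans _ _ (\int[lebesgue_tuple d]_(x in cube d) I%:E)).
  rewrite integral_cst; last exact: measurable_cube.
  by rewrite [X in _ * X](_ : _ = 1) ?mule1//; exact: lebesgue_cube.
apply: ge0_le_integral => //.
- exact: measurable_cube.
- exact: measurable_funTS.
move=> x xc; apply: (@le_trans _ _ (\int[leb]_(y in window (m x)) I%:E)).
  rewrite integral_cst; last exact: measurable_window.
  by rewrite [X in _ * X](_ : _ = 1) ?mule1//; exact: lebesgue_window.
apply: ge0_le_integral => //.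
- exact: measurable_window.
- by apply: measurable_funTS; exact: (measurableT_comp mF).
- by move=> y yw; rewrite lee_fin IF//; exact: (window_potential_raw mC).
Qed.

End raw_law_distance.

(** * Bump functions and balls for the supremum distance *)

Section bumps.
Context {R : realType}.

Lemma bigmax_dist (I : finType) (f g : I -> R) (e : R) : 0 <= e ->
  (forall i, `|f i - g i| <= e) ->
  `|\big[Num.max/0]_i f i - \big[Num.max/0]_i g i| <= e.
Proof.
move=> e0 fg.
have onesided (u v : I -> R) : (forall i, u i <= v i + e) ->
    \big[Num.max/0]_i u i <= \big[Num.max/0]_i v i + e.
  move=> uv; apply: bigmax_le; first by rewrite addr_ge0// bigmax_ge_id.
  by move=> i _; rewrite (le_trans (uv i))// lerD2r; exact: le_bigmax.
rewrite ler_norml; apply/andP; split.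
  rewrite lerBrDr addrC lerBlDr; apply: onesided => i.
  by have := fg i; rewrite ler_norml => /andP[? _]; lra.
rewrite lerBlDr addrC; apply: onesided => i.
by have := fg i; rewrite ler_norml => /andP[_ ?]; lra.
Qed.

(** Subadditivity of u -> u^b: writing v = x u with x in [0,1], both x and 1 - x
   are at most their b-th powers. *)
Lemma powR_dist (b u v : R) : 0 < b <= 1 -> 0 <= u -> 0 <= v ->
  `|u `^ b - v `^ b| <= `|u - v| `^ b.
Proof.
move=> /andP[b0 b1].
wlog vu : u v / v <= u => [hw u0 v0|u0 v0].
  have [|/ltW uv] := leP v u; first by move=> ?; exact: hw.
  by rewrite distrC [in leRHS]distrC; exact: hw.
rewrite ger0_norm ?subr_ge0; last first.
  by apply: ge0_ler_powR; rewrite ?nnegrE//; exact: ltW.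
rewrite ger0_norm ?subr_ge0//.
have [u00|un0] := eqVneq u 0.
  have -> : v = u by lra.
  by rewrite !subrr powR_ge0.
have up : 0 < u by rewrite lt0r un0.
have le_pow x : 0 <= x <= 1 -> x <= x `^ b.
  move=> /andP[x0 x1]; have [->|xn0] := eqVneq x 0; first exact: powR_ge0.
  by apply: ger1_powR => //; rewrite lt0r xn0 x0.
have [x x01 vE] : exists2 x, 0 <= x <= 1 & v = x * u.
  by exists (v / u); rewrite ?divfK// divr_ge0//= ler_pdivrMr// mul1r.
have /andP[x0 x1] := x01.
have uvE : u - v = (1 - x) * u by rewrite mulrBl mul1r -vE.
have y0 : 0 <= 1 - x by lra.
rewrite uvE {1}vE !powRM//.
have := le_pow x x01; have := le_pow (1 - x) _; rewrite y0 gerBl x0 => /(_ isT).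
have := powR_ge0 u b; move: (u `^ b) => U U0. nra.
Qed.

Context {d : nat}.
Implicit Types x y a : d.-tuple R.

Lemma coord_le_edist x y i : `|tnth x i - tnth y i| <= edist x y.
Proof.
rewrite /edist -sqrtr_sqr ler_wsqrtr// (bigD1 i)//= lerDl.
by apply: sumr_ge0 => j _; exact: sqr_ge0.
Qed.

Lemma edist_ge0 x y : 0 <= edist x y.
Proof. exact: sqrtr_ge0. Qed.

(** The balls of this distance are cubes, which tile [0,1]^d and whose volumes
   are products of lengths; it is dominated by the Euclidean distance, so Hoelder
   bounds for it are also Hoelder bounds for the latter. *)
Definition supdist x y : R := \big[Num.max/0]_(i < d) `|tnth x i - tnth y i|.

Lemma supdist_lipschitz a x y : `|supdist x a - supdist y a| <= edist x y.
Proof.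
apply: bigmax_dist; first exact: edist_ge0.
move=> i; apply: le_trans (coord_le_edist x y i).
by rewrite (le_trans (ler_dist_dist _ _))// opprB addrA subrK.
Qed.

Definition bump (b c r : R) a x : R := c * (Num.max (r - supdist x a) 0) `^ b.

Lemma bump_holder b c r a : 0 < b <= 1 -> 0 <= c -> holder b c (bump b c r a).
Proof.
move=> b01 c0 x y; have /andP[b0 _] := b01.
rewrite /bump -mulrBr normrM ger0_norm//; apply: ler_wpM2l => //.
apply: le_trans (powR_dist b01 _ _) _; rewrite ?le_max ?lexx ?orbT//.
apply: ge0_ler_powR; rewrite ?nnegrE ?(ltW b0)//; first exact: edist_ge0.
apply: le_trans (supdist_lipschitz a x y).
move: (supdist x a) (supdist y a) => p q.
have := ler_norm (p - q); have := ler_norm (q - p); rewrite distrC => h1 h2.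
rewrite ler_norml !maxEle; apply/andP.
by case: ifP => ?; case: ifP => ?; split; lra.
Qed.

Lemma bump_ge0 b c r a x : 0 <= c -> 0 <= bump b c r a x.
Proof. by move=> c0; rewrite mulr_ge0// powR_ge0. Qed.

Lemma bump_le b c r a x : 0 < b -> 0 <= c -> 0 <= r -> bump b c r a x <= c * r `^ b.
Proof.
move=> b0 c0 r0; apply: ler_wpM2l => //; apply: ge0_ler_powR.
- exact: ltW.
- by rewrite nnegrE le_max lexx orbT.
- by rewrite nnegrE.
- by rewrite ge_max r0 andbT lerBlDr lerDl; exact: bigmax_ge_id.
Qed.

Lemma bump_out b c r a x i : 0 < b -> r <= `|tnth x i - tnth a i| -> bump b c r a x = 0.
Proof.
move=> b0 ri; rewrite /bump (_ : Num.max _ _ = 0) ?powR0 ?mulr0 ?gt_eqF//.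
apply/max_idPr; rewrite subr_le0 (le_trans ri)//.
exact: (le_bigmax 0 (fun i => `|tnth x i - tnth a i|)).
Qed.

Lemma bump_in b c r a x : 0 < b -> 0 <= c -> 0 <= r ->
  (forall i, `|tnth x i - tnth a i| <= r / 2) -> c * (r / 2) `^ b <= bump b c r a x.
Proof.
move=> b0 c0 r0 xr; apply: ler_wpM2l => //; apply: ge0_ler_powR.
- exact: ltW.
- by rewrite nnegrE divr_ge0.
- by rewrite nnegrE le_max lexx orbT.
- rewrite le_max; apply/orP; left.
  have : supdist x a <= r / 2 by apply: bigmax_le => //; rewrite divr_ge0.
  lra.
Qed.

End bumps.

Section sup_balls.
Context {R : realType}.

Definition supball d (a : d.-tuple R) (rho : R) : set (d.-tuple R) :=
  [set x | forall i, `|tnth x i - tnth a i| <= rho].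

Lemma measurable_supball d (a : d.-tuple R) rho : measurable (supball a rho).
Proof.
have -> : supball a rho =
    \bigcap_(i : 'I_d) ((@tnth d R)^~ i @^-1` `[tnth a i - rho, tnth a i + rho]).
  apply/seteqP; split => x xd i.
    move=> _ /=; rewrite in_itv/=; have := xd i; rewrite ler_norml => /andP[? ?].
    by apply/andP; split; lra.
  have := xd i I; rewrite /= in_itv/= => /andP[? ?].
  by rewrite ler_norml; apply/andP; split; lra.
apply: fin_bigcap_measurable; first exact: finite_finset.
move=> i _; rewrite -[X in measurable X]setTI.
by apply: measurable_tnth => //; exact: measurable_itv.
Qed.

Lemma lebesgue_supball d (a : d.-tuple R) rho : 0 < rho ->
  lebesgue_tuple d (supball a rho) = ((2 * rho) ^+ d)%:E.
Proof.
move=> rho0; elim: d a => [|d IH] a.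
  by rewrite /= diracE mem_set//= => -[].
case/tupleP: a => a0 a; rewrite /= /lebesgue_succ /pushforward.
have -> : @tcons R d @^-1` supball [tuple of a0 :: a] rho =
    `[a0 - rho, a0 + rho]%classic `*` supball a rho.
  apply/seteqP; split => [[x t] /= H|[x t] /= [x01 H] i].
    split; last by move=> i; have := H (lift ord0 i); rewrite !tnthS.
    have := H ord0; rewrite !tnth0 in_itv/= ler_norml.
    by move=> /andP[? ?]; apply/andP; split; lra.
  case: (unliftP ord0 i) => [j ->|->]; first by rewrite !tnthS; exact: H.
  move: x01; rewrite !tnth0 in_itv/= ler_norml.
  by move=> /andP[? ?]; apply/andP; split; lra.
rewrite product_measure1E//; last exact: measurable_supball.
rewrite IH exprS EFinM; congr (_ * _)%E.
have := @lebesgue_measure_itv R `[a0 - rho, a0 + rho].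
rewrite /= lte_fin => ->; rewrite (_ : (_ < _) = true); last by apply/idP; lra.
by rewrite -EFinB; congr EFin; lra.
Qed.

End sup_balls.

(** * The cube of regression functions *)

Lemma far_coord {R : realType} d (a x : d.-tuple R) (rho : R) :
  ~ supball a rho x -> exists i, rho <= `|tnth x i - tnth a i|.
Proof.
apply: contra_notP => far i; have [//|/ltW xi] := leP `|tnth x i - tnth a i| rho.
by case: far; exists i.
Qed.

Section hypercube.
Context {R : realType}.
Variables (d N : nat) (beta c C M : R).
Hypotheses (N_gt0 : (0 < N)%N) (beta01 : 0 < beta <= 1).
Hypotheses (c_gt0 : 0 < c) (c_le_C : c <= C) (c_le_M : c <= M).

Local Notation J := {ffun 'I_d -> 'I_N}.
Local Notation vertex := {ffun J -> bool}.

(** Half the side of a cell. *)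
Definition radius : R := (2 * N%:R)^-1.
Local Notation r := radius.

Let beta_gt0 : 0 < beta. Proof. by case/andP: beta01. Qed.

Let N_gt0R : 0 < N%:R :> R. Proof. by rewrite ltr0n. Qed.

Lemma radius_gt0 : 0 < r.
Proof. by rewrite invr_gt0 mulr_gt0. Qed.

Lemma radius_le1 : r <= 1.
Proof.
rewrite invf_le1 ?mulr_gt0//.
have : 1 <= N%:R :> R by rewrite ler1n.
lra.
Qed.

Lemma radiusE : 2 * N%:R * r = 1.
Proof. by rewrite mulfV// gt_eqF// mulr_gt0. Qed.

Definition center (j : J) : d.-tuple R :=
  [tuple (2 * (j i)%:R + 1) * r | i < d].

Lemma center_sep j k : j != k ->
  exists i, 2 * r <= `|tnth (center j) i - tnth (center k) i|.
Proof.
move=> jk; have [i ji] : exists i, j i != k i.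
  apply/existsP; apply: contraNT jk => /existsPn H.
  by apply/eqP/ffunP => i; have := H i; rewrite negbK => /eqP.
exists i; rewrite !tnth_mktuple -mulrBl normrM (gtr0_norm radius_gt0).
apply: ler_wpM2r; first exact/ltW/radius_gt0.
have lt1 (p q : nat) : (p < q)%N -> 2 <= `|(2 * q%:R + 1) - (2 * p%:R + 1)| :> R.
  by rewrite -(ler_nat R) -natr1 => pq; apply: le_trans (ler_norm _); lra.
by move: ji; rewrite -val_eqE neq_ltn => /orP[/lt1|/lt1]; rewrite // distrC.
Qed.

(** The half-size cube in the middle of a cell, on which the bump is at least a
   fixed fraction of its height. *)
Definition core (j : J) : set (d.-tuple R) := supball (center j) (r / 2).

Lemma measurable_core j : measurable (core j).
Proof. exact: measurable_supball. Qed.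

Lemma lebesgue_core j : lebesgue_tuple d (core j) = (r ^+ d)%:E.
Proof.
rewrite lebesgue_supball ?divr_gt0 ?radius_gt0//.
by congr ((_ ^+ _)%:E); lra.
Qed.

Lemma center_cube j i (u : R) : `|u - tnth (center j) i| <= r -> 0 <= u <= 1.
Proof.
rewrite tnth_mktuple ler_norml => /andP[u1 u2].
have jN : (j i)%:R + 1 <= N%:R :> R by rewrite natr1 ler_nat.
have j0 : 0 <= (j i)%:R :> R by [].
have := radiusE; have := radius_gt0; move: u1 u2.
move: ((j i)%:R) j0 jN => p p0 pN u1 u2 r0 rE; apply/andP; split; nra.
Qed.

Lemma core_cube j : core j `<=` cube d.
Proof.
move=> x xj i; apply: (@center_cube j); apply: le_trans (xj i) _.
have := radius_gt0; lra.
Qed.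

Lemma core_far j k x : j != k -> core j x ->
  exists i, r <= `|tnth x i - tnth (center k) i|.
Proof.
move=> /center_sep[i jk] /(_ i) xj; exists i.
have := ler_distD (tnth x i) (tnth (center j) i) (tnth (center k) i).
rewrite [X in _ <= X + _]distrC; have := radius_gt0; lra.
Qed.

Lemma core_disjoint : trivIset setT core.
Proof.
apply/trivIsetP => j k _ _ jk; apply/seteqP; split => // x [/(core_far jk)[i xi]].
by move=> /(_ i); have := radius_gt0; lra.
Qed.

Local Notation b j := (bump beta c r (center j)).

(** A maximum rather than a sum of bumps: a maximum of Hoelder functions is Hoelder
   with the same constant, whatever the number of bumps, and toggling one bump
   moves it by at most that bump. As the bumps have disjoint supports the two
   coincide. *)
Definition vertex_fun (theta : vertex) (x : d.-tuple R) : R :=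
  \big[Num.max/0]_j (if theta j then b j x else 0).

Lemma vertex_fun_holder theta : holder beta c (vertex_fun theta).
Proof.
move=> x y; apply: bigmax_dist; first by rewrite mulr_ge0 ?powR_ge0// ltW.
move=> j; case: ifP => _; last by rewrite subrr normr0 mulr_ge0 ?powR_ge0// ltW.
exact/bump_holder/ltW.
Qed.

Definition vertex_mfun (theta : vertex) : {mfun d.-tuple R >-> R} :=
  HB.pack (vertex_fun theta) (isMeasurableFun.Build _ _ _ _ _
    (holder_measurable beta_gt0 (@vertex_fun_holder theta))).

Lemma vertex_mfunE theta x : vertex_mfun theta x = vertex_fun theta x.
Proof. by []. Qed.

Lemma vertex_class theta : regression_class beta C M (vertex_mfun theta).
Proof.
split=> [x y|x /=|x].
- apply: le_trans (vertex_fun_holder theta x y) _.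
  by apply: ler_wpM2r => //; exact: powR_ge0.
- move=> /eqP mx; apply: contrapT => xc; apply: mx.
  apply: bigmax_eq_id => j _; case: ifP => // _.
  have [i xi] : exists i, r <= `|tnth x i - tnth (center j) i|.
    by apply: far_coord; apply: contra_not xc => xj i; exact: (center_cube (xj i)).
  by rewrite (bump_out _ _ xi).
- apply: bigmax_le => [|j _]; first exact/ltW/(lt_le_trans c_gt0 c_le_M).
  apply: le_trans c_le_M; case: ifP => _; last exact: ltW.
  apply: le_trans (bump_le _ _ beta_gt0 (ltW c_gt0) (ltW radius_gt0)) _.
  apply: ler_piMr; first exact: ltW.
  have <- : 1 `^ beta = 1 :> R by rewrite powR1.
  apply: ge0_ler_powR; rewrite ?nnegrE//; first exact: ltW.
    exact/ltW/radius_gt0.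
  exact: radius_le1.
Qed.

Definition flip (j : J) (theta : vertex) : vertex :=
  [ffun k => if k == j then ~~ theta k else theta k].

Lemma flipK j : involutive (flip j).
Proof.
by move=> theta; apply/ffunP => k; rewrite !ffunE; case: (k == j); rewrite ?negbK.
Qed.

Lemma flip_dist_le j theta x :
  `|vertex_mfun theta x - vertex_mfun (flip j theta) x| <= b j x.
Proof.
apply: bigmax_dist; first exact/bump_ge0/ltW.
move=> k; rewrite ffunE; case: (eqVneq k j) => [->|_].
  by case: (theta j) => /=; rewrite ?subr0 ?sub0r ?normrN ger0_norm//; apply/bump_ge0/ltW.
by rewrite subrr normr0; apply/bump_ge0/ltW.
Qed.

(** All other centers are at distance at least [radius] from this core, so only
   the bump of index j can be nonzero there. *)
Lemma vertex_fun_core j theta x : core j x ->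
  vertex_fun theta x = if theta j then b j x else 0.
Proof.
move=> xj; rewrite /vertex_fun (bigmaxD1 j)//=.
rewrite [X in Num.max _ X](_ : _ = 0); last first.
  apply: bigmax_eq_id => k kj; case: ifP => // _.
  have jk : j != k by rewrite eq_sym.
  have [i xi] := core_far jk xj.
  by rewrite (bump_out _ _ xi).
by apply/max_idPl; case: ifP => // _; apply/bump_ge0/ltW.
Qed.

Lemma flip_dist_core j theta x : core j x ->
  c * (r / 2) `^ beta <= `|vertex_mfun theta x - vertex_mfun (flip j theta) x|.
Proof.
move=> xj; rewrite !vertex_mfunE !(vertex_fun_core _ xj) ffunE eqxx.
have b0 : 0 <= b j x by apply/bump_ge0/ltW.
apply: (@le_trans _ _ (b j x)).
  by apply: bump_in => //; [exact: ltW|exact/ltW/radius_gt0].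
by case: (theta j) => /=; rewrite ?subr0 ?sub0r ?normrN ger0_norm.
Qed.

Lemma flip_dist_L1 j theta :
  (\int[lebesgue_tuple d]_(x in cube d)
      (`|vertex_mfun theta x - vertex_mfun (flip j theta) x|)%:E
    <= (c * r `^ beta * (2 * r) ^+ d)%:E)%E.
Proof.
have cr0 : 0 <= c * r `^ beta by rewrite mulr_ge0 ?powR_ge0// ltW.
have mb := measurable_supball (center j) r.
rewrite EFinM -(lebesgue_supball (center j) radius_gt0) -integral_cst//.
rewrite [leLHS]integral_mkcond [leRHS]integral_mkcond.
have md : measurable_fun setT
    (fun x => (`|vertex_mfun theta x - vertex_mfun (flip j theta) x|)%:E).
  apply/measurable_EFinP; apply: measurableT_comp => //.
  by apply: measurable_funB; exact: measurable_funPT.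
apply: ge0_le_integral => //.
- by move=> x _; rewrite patchE; case: ifP.
- by apply/(measurable_restrictT _ _).1; [exact: measurable_cube|exact: measurable_funTS].
- by apply/(measurable_restrictT _ _).1.
- move=> x _; rewrite !patchE; case: ifPn => _; case: ifPn; rewrite ?lee_fin//.
    move=> _; apply: le_trans (flip_dist_le _ _ _) _.
    by apply: bump_le => //; [exact: ltW|exact/ltW/radius_gt0].
  rewrite notin_setE => xj; apply: le_trans (flip_dist_le _ _ _) _.
  have [i xi] : exists i, r <= `|tnth x i - tnth (center j) i|.
    exact: far_coord.
  by rewrite (bump_out _ _ xi).
Qed.

End hypercube.

(** * From two-point bounds to the risk *)

Section two_points.
Context {R : realType} {dH} {H : measurableType dH}.
Local Open Scope ereal_scope.

(** Capping g at D and rescaling it to 1 - f turns the two losses into the two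
   errors of a randomized test: they are at least D (1 - p) and D q, where p and q
   are the means of f under L and L'. Since f^2 <= f, the hypothesis gives
   p^2 <= 2 q, and 1 - p + p^2 / 2 >= 1 / 2. *)
Lemma two_point_loss (L L' : probability H R) (g g' : H -> \bar R) (D : R) :
    (0 < D)%R -> measurable_fun setT g -> measurable_fun setT g' ->
    (forall z, 0 <= g z) -> (forall z, 0 <= g' z) ->
    (forall z, D%:E <= g z + g' z) ->
    (forall f, is_test f -> (\int[L]_z f z) ^+ 2 <= 2 * \int[L']_z (f z ^+ 2))%R ->
  (D / 2)%:E <= \int[L]_z g z + \int[L']_z g' z.
Proof.
move=> D0 mg mg' g0 g'0 gg' LL'.
pose h z := mine (g z) D%:E.
have h0 z : 0 <= h z by rewrite le_min g0 lee_fin ltW.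
have hD z : h z <= D%:E by rewrite ge_min lexx orbT.
have hfin z : (fine (h z))%:E = h z.
  by rewrite fineK// ge0_fin_numE// (le_lt_trans (hD z))// ltry.
pose f z := (1 - fine (h z) / D)%R.
have hE z : fine (h z) = (D * (1 - f z))%R.
  by rewrite /f opprB addrC subrK mulrCA divff ?gt_eqF// mulr1.
have tf : is_test f.
  split.
    apply: measurable_funB => //; apply: measurable_funM => //.
    by apply: measurableT_comp => //; exact: measurable_mine.
  move=> z; have : (0 <= fine (h z) <= D)%R by rewrite -!lee_fin hfin h0 hD.
  move=> /andP[z0 zD]; rewrite /f subr_ge0 ler_pdivrMr// mul1r zD/=.
  by rewrite gerBl divr_ge0// ltW.
have bf := test_bounded tf.
have b1f : bounded_measurable (fun z => 1 + -1 * f z)%R.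
  by apply: bounded_add; [exact: bounded_cst|exact: (bounded_mul (bounded_cst _))].
have lower (P : probability H R) (k : R) (u : H -> R) (w : H -> \bar R) : (0 <= k)%R -> bounded_measurable u ->
    measurable_fun setT w -> (forall z, 0 <= (k * u z)%R)%R ->
    (forall z, (k * u z)%:E <= w z) -> (k * \int[P]_z u z)%:E <= \int[P]_z w z.
  move=> k0 bu mw u0 uw; rewrite -RintegralZ_bounded// EFin_Rintegral; last first.
    exact: (bounded_mul (bounded_cst _)).
  apply: ge0_le_integral => //; first by move=> z _; rewrite lee_fin.
  by apply/measurable_EFinP; exact: (bounded_mul (bounded_cst k) bu).1.
have f01 z : (0 <= f z <= 1)%R by case: tf.
have Lg : (D * \int[L]_z (1 + -1 * f z))%:E <= \int[L]_z g z.
  apply: lower => //; first exact: ltW.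
    by move=> z; rewrite mulr_ge0 ?(ltW D0)//; have := f01 z; lra.
  by move=> z; rewrite mulN1r -hE hfin ge_min lexx.
have L'g : (D * \int[L']_z f z)%:E <= \int[L']_z g' z.
  apply: lower => //; first exact: ltW.
    by move=> z; rewrite mulr_ge0 ?(ltW D0)//; have /andP[] := f01 z.
  move=> z; have -> : (D * f z)%R = (D - fine (h z))%R by rewrite hE; ring.
  rewrite EFinB hfin leeBlDr; last by rewrite -hfin.
  rewrite /h minEle; case: ifP => _; first by rewrite addeC.
  by rewrite addeC leeDl.
apply: le_trans (leeD Lg L'g).
rewrite -EFinD lee_fin.
rewrite RintegralD_bounded ?Rintegral_cst_prob; [|exact: bounded_cst|exact: (bounded_mul (bounded_cst _))].
rewrite RintegralZ_bounded//.
have := LL' f tf.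
have : (\int[L']_z (f z ^+ 2) <= \int[L']_z f z)%R.
  apply: le_Rintegral_bounded => //; first exact/test_bounded/test_sqr.
  by move=> z; have := f01 z; nra.
move: (\int[L]_z f z)%R (\int[L']_z f z)%R (\int[L']_z (f z ^+ 2))%R => p q s sq ps.
have : (0 <= (p - 1) ^+ 2)%R by exact: sqr_ge0.
rewrite -mulrDr; move=> p1.
rewrite ler_pM2l//; nra.
Qed.

End two_points.

Section local_losses.
Context {R : realType} {d : nat} {dH} {H : measurableType dH}.
Variable mt : H -> d.-tuple R -> R.
Hypothesis mtP : estimator mt.
Local Open Scope ereal_scope.
Local Notation mu := (lebesgue_tuple d).

Definition local_loss (S : set (d.-tuple R)) (m : d.-tuple R -> R) (z : H) : \bar R :=
  \int[mu]_(x in S) ((mt z x - m x) ^+ 2)%:E.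

Section one_region.
Variables (S : set (d.-tuple R)) (m : {mfun d.-tuple R >-> R}).
Hypotheses (mS : measurable S) (Scube : S `<=` cube d).

Let loss_on (w : H * d.-tuple R) : \bar R :=
  ((fun w => ((mt w.1 w.2 - m w.2) ^+ 2)%:E) \_ (setT `*` S)) w.

Let loss_on_ge0 w : 0 <= loss_on w.
Proof. by rewrite /loss_on patchE; case: ifP => // _; rewrite lee_fin sqr_ge0. Qed.

Let measurable_loss_on : measurable_fun setT loss_on.
Proof.
apply/(measurable_restrictT _ _).1; first exact: measurableX.
apply/measurable_EFinP; apply: measurable_funX; apply: measurable_funB.
  apply: measurable_funS mtP; first by apply: measurableX => //; exact: measurable_cube.
  by move=> [z x] [_ /Scube].
apply: measurable_funTS.
exact: (measurableT_comp (measurable_funPT m) measurable_snd).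
Qed.

Let loss_onE z x : loss_on (z, x) = ((fun x => ((mt z x - m x) ^+ 2)%:E) \_ S) x.
Proof.
rewrite /loss_on !patchE; congr (if _ then _ else _).
by apply/idP/idP; rewrite !inE/=; [case|move=> ?; split].
Qed.

Lemma measurable_local_loss : measurable_fun setT (local_loss S m).
Proof.
have := measurable_fun_fubini_tonelli_F (m2 := mu) loss_on measurable_loss_on loss_on_ge0.
congr measurable_fun; apply/funext => z; rewrite /local_loss [RHS]integral_mkcond.
by apply: eq_integral => x _; rewrite loss_onE.
Qed.

Lemma measurable_loss_section z :
  measurable_fun S (fun x => ((mt z x - m x) ^+ 2)%:E).
Proof.
apply/(measurable_restrictT _ _).2 => //.
rewrite (_ : (fun x => _) \_ S = loss_on \o pair z); last first.
  by apply/funext => x; rewrite /= loss_onE.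
by apply: measurableT_comp => //; exact: measurable_pair1.
Qed.

Lemma local_loss_ge0 z : 0 <= local_loss S m z.
Proof. by apply: integral_ge0 => x _; rewrite lee_fin sqr_ge0. Qed.

End one_region.

(** (y - u)^2 + (y - v)^2 >= (u - v)^2 / 2 for every estimate y. *)
Lemma local_loss_sum_ge (S : set (d.-tuple R)) (m m' : {mfun d.-tuple R >-> R})
    (v Delta : R) z :
  measurable S -> S `<=` cube d -> mu S = v%:E -> (0 <= Delta)%R ->
  (forall x, S x -> Delta <= `|m x - m' x|)%R ->
  (Delta ^+ 2 / 2 * v)%:E <= local_loss S m z + local_loss S m' z.
Proof.
move=> mS Sc Sv D0 SD.
rewrite /local_loss -ge0_integralD//; last 4 first.
- by move=> x _; rewrite lee_fin sqr_ge0.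
- exact: measurable_loss_section.
- by move=> x _; rewrite lee_fin sqr_ge0.
- exact: measurable_loss_section.
rewrite EFinM -Sv -integral_cst//; apply: ge0_le_integral => //.
- by move=> x _; rewrite lee_fin divr_ge0// sqr_ge0.
- by apply: emeasurable_funD; exact: measurable_loss_section.
- move=> x /SD; rewrite -EFinD lee_fin => Dx.
  have : (Delta ^+ 2 <= (m x - m' x) ^+ 2)%R.
    by rewrite -[leRHS]real_normK ?num_real// ler_sqr ?nnegrE.
  have := sqr_ge0 ((mt z x - m x) + (mt z x - m' x))%R.
  by move: (mt z x) (m x) (m' x) => p q q'; nra.
Qed.

Lemma sum_local_loss_le (J : finType) (S : J -> set (d.-tuple R))
    (m : {mfun d.-tuple R >-> R}) z :
  (forall j, measurable (S j)) -> (forall j, S j `<=` cube d) -> trivIset setT S ->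
  \sum_(j : J) local_loss (S j) m z <= local_loss (cube d) m z.
Proof.
move=> mS Sc tS; have mc : measurable (cube d : set (d.-tuple R)) by exact: measurable_cube.
have ml := measurable_loss_section m mc (@subset_refl _ _) z.
have Uc : \big[setU/set0]_(j <- index_enum J) S j `<=` cube d.
  by move=> x; rewrite -bigcup_seq => -[j _]; exact: Sc.
have mU : measurable (\big[setU/set0]_(j <- index_enum J) S j).
  by apply: bigsetU_measurable.
rewrite -(@ge0_integral_bigsetU _ _ _ mu J S _ (index_enum J))//.
- apply: ge0_subset_integral => //.
  by move=> x _; rewrite lee_fin sqr_ge0.
- exact: index_enum_uniq.
- exact: sub_trivIset tS.
- exact: measurable_funS ml.
- by move=> x _; rewrite lee_fin sqr_ge0.
Qed.

End local_losses.

Section assouad.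
Context {R : realType}.

(** The average of X j over the vertices is unchanged by the flip of coordinate j,
   so it is at least eps / 2; sum over j and compare the average with s. *)
Lemma assouad (J V : finType) (flip : J -> V -> V) (X : J -> V -> \bar R)
    (s : \bar R) (eps : R) (v0 : V) :
  (forall j, involutive (flip j)) -> (forall j v, 0 <= X j v)%E ->
  (forall v, \sum_j X j v <= s)%E ->
  (forall j v, eps%:E <= X j v + X j (flip j v))%E ->
  ((#|J|%:R * (eps / 2))%:E <= s)%E.
Proof.
move=> flipK X0 Xs Xeps.
have Xjs j v : (X j v <= s)%E.
  apply: le_trans (Xs v); rewrite (bigD1 j)//= leeDl//.
  by apply: sume_ge0 => k _; exact: X0.
case: s Xs Xjs => [s| |] Xs Xjs; [|by rewrite leey|]; last first.
  have s0 : (0 <= \sum_j X j v0)%E by apply: sume_ge0 => j _; exact: X0.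
  by have := le_trans s0 (Xs v0).
pose x j v := fine (X j v).
have xE j v : X j v = (x j v)%:E.
  by rewrite /x fineK// ge0_fin_numE// (le_lt_trans (Xjs j v))// ltry.
have xs v : \sum_j x j v <= s.
  rewrite -lee_fin -sumEFin; apply: le_trans (Xs v); rewrite le_eqVlt; apply/orP; left.
  by apply/eqP; apply: eq_bigr => j _; rewrite xE.
have xeps j v : eps <= x j v + x j (flip j v).
  by rewrite -lee_fin EFinD -!xE.
have V0 : 0 < #|V|%:R :> R by rewrite ltr0n; apply/card_gt0P; exists v0.
have half j : #|V|%:R * (eps / 2) <= \sum_v x j v.
  have : \sum_(v : V) eps <= \sum_v (x j v + x j (flip j v)) by apply: ler_sum.
  have flipE : \sum_v x j (flip j v) = \sum_v x j v.
    by rewrite [RHS](reindex_inj (inv_inj (flipK j))).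
  rewrite big_split/= flipE.
  by rewrite sumr_const -[_ *+ _]mulr_natl; lra.
rewrite lee_fin -(ler_pM2l V0).
apply: (@le_trans _ _ (\sum_j \sum_v x j v)).
  rewrite mulrCA mulr_natl -sumr_const.
  by apply: ler_sum => j _; exact: half.
rewrite exchange_big/= mulr_natl -sumr_const.
by apply: ler_sum => v _; exact: xs.
Qed.

End assouad.

(** * The lower bound at a given scale *)

Section minimax_lower_bound.
Context {R : realType} {d N n : nat}.
Variables (beta c C M a : R).
Hypotheses (N_gt0 : (0 < N)%N) (beta01 : 0 < beta <= 1).
Hypotheses (c_gt0 : 0 < c) (c_le_C : c <= C) (c_le_M : c <= M) (a_ge0 : 0 <= a).

Local Notation r := (radius N : R).
Let t : R := c * r `^ beta * (2 * r) ^+ d.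
Hypothesis budget : (1 + ((expR a - 1) * t) ^+ 2) ^+ n <= 2.

Context {dH} {H : measurableType dH}.
Variables (Q : mechanism (R := R) (d.-tuple R * R)%type H n) (mt : H -> d.-tuple R -> R).
Hypotheses (mtP : estimator mt) (Qa : locally_private a%:E (potential_raw beta C M) Q).

Local Notation J := {ffun 'I_d -> 'I_N}.
Local Notation vertex := {ffun J -> bool}.
Local Notation m theta := (vertex_mfun beta01 c_gt0 theta).
Let mC (theta : vertex) : regression_class beta C M (m theta) :=
  vertex_class N_gt0 beta01 c_gt0 c_le_C c_le_M theta.

Lemma flip_second_moment (j : J) (theta : vertex) (f : H -> R) : is_test f ->
  (\int[private_law (raw_law (m theta)) Q]_z f z) ^+ 2 <=
  2 * \int[private_law (raw_law (m (flip j theta))) Q]_z (f z ^+ 2).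
Proof.
move=> tf.
have t0 : 0 <= t.
  have r0 : 0 <= r by exact/ltW/radius_gt0.
  by rewrite /t !mulr_ge0 ?powR_ge0 ?exprn_ge0 ?mulr_ge0 ?(ltW c_gt0).
have v0P : potential_raw beta C M (center j, m theta (center j)).
  apply: (window_potential_raw (mC theta)).
    apply: (@core_cube R d N N_gt0 j) => i; rewrite subrr normr0 divr_ge0//.
    exact/ltW/radius_gt0.
  by rewrite /window/= in_itv/=; apply/andP; split; lra.
have close := raw_law_close (mC theta) (mC (flip j theta))
  (flip_dist_L1 N_gt0 beta01 c_gt0 j theta).
have := second_moment_private_law t0 close (raw_law_carried (mC (flip j theta)))
  a_ge0 v0P Qa tf.
move/le_trans; apply; apply: ler_wpM2r => //.
by apply: Rintegral_ge0 => z _; exact: sqr_ge0.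
Qed.

Let Delta : R := c * (r / 2) `^ beta.

Let Delta_gt0 : 0 < Delta.
Proof. by rewrite mulr_gt0// powR_gt0// divr_gt0// radius_gt0. Qed.

(** [assouad] with X j theta the part of the risk incurred on the core of index j:
   the cores are disjoint, so these parts add up to at most the risk. *)
Lemma risk_lower_bound (s : \bar R) :
  (forall theta : vertex, (risk Q mt (m theta) <= s)%E) ->
  (((N ^ d)%N%:R * (Delta ^+ 2 / 2 * r ^+ d / 2 / 2))%:E <= s)%E.
Proof.
move=> Qs.
pose X (j : J) (theta : vertex) :=
  (\int[private_law (raw_law (m theta)) Q]_z local_loss mt (core j) (m theta) z)%E.
have <- : #|J| = (N ^ d)%N by rewrite card_ffun !card_ord.
have mloss j theta := measurable_local_loss mtP (m theta) (@measurable_core R d N j)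
  (@core_cube R d N N_gt0 j).
apply: (@assouad R J vertex (@flip d N) X s _ [ffun=> false]).
- exact: flipK.
- by move=> j theta; apply: integral_ge0 => z _; exact: local_loss_ge0.
- move=> theta; apply: le_trans (Qs theta); rewrite /X /risk.
  rewrite -ge0_integral_sum//; last by move=> j z _; exact: local_loss_ge0.
  apply: ge0_le_integral => //.
  + by move=> z _; apply: sume_ge0 => j _; exact: local_loss_ge0.
  + exact: emeasurable_sum.
  + apply: (measurable_local_loss mtP) => //; exact: measurable_cube.
  + move=> z _; apply: sum_local_loss_le => //.
    * by move=> j; exact: measurable_core.
    * by move=> j; exact: core_cube.
    * exact: core_disjoint.
- move=> j theta; apply: two_point_loss.
  + by rewrite mulr_gt0 ?exprn_gt0 ?radius_gt0// divr_gt0// exprn_gt0.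
  + exact: mloss.
  + exact: mloss.
  + by move=> z; exact: local_loss_ge0.
  + by move=> z; exact: local_loss_ge0.
  + move=> z; apply: local_loss_sum_ge => //.
    * exact: measurable_core.
    * exact: core_cube.
    * exact: lebesgue_core.
    * exact: ltW.
    * by move=> x xj; exact: flip_dist_core.
  + by move=> f tf; exact: flip_second_moment.
Qed.

End minimax_lower_bound.

(** * Choice of the scale *)

Section rate.
Context {R : realType}.

Lemma expR_quarter : expR (4^-1) <= 2 :> R.
Proof.
have := @expR_ge1Dx R (- 4^-1); rewrite expRN => h.
have e0 := expR_gt0 (4^-1 : R).
have : (1 - 4^-1) * expR (4^-1 : R) <= 1 by rewrite -ler_pdivlMr// mul1r.
lra.
Qed.

(** (1 + y)^n <= e^(n y). *)
Lemma expn1D_le2 (n : nat) (y : R) : n%:R * y <= 4^-1 -> 0 <= y -> (1 + y) ^+ n <= 2.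
Proof.
move=> ny y0; apply: le_trans expR_quarter.
apply: (@le_trans _ _ (expR (n%:R * y))); last by rewrite ler_expR.
by rewrite expRM_natl lerXn2r ?nnegrE ?expR_ge0 ?addr_ge0// expR_ge1Dx.
Qed.

(** N is the least integer above x = s^(1 / (2 (p + q))). It is at most twice
   max(1, x), and x^(2p) = s^(p / (p + q)); hence N^(-2p) is, up to the constant
   2^(2p), at least any rho below both 1 and s^(-p / (p + q)). The condition on
   rho is written without division so as to allow s = 0. *)
Lemma grid_size (s p q : R) : 0 <= s -> 0 < p -> 0 < q ->
  exists2 N : nat, (0 < N)%N & s <= (N%:R `^ (p + q)) ^+ 2 /\
    forall rho, 0 <= rho -> rho <= 1 -> rho * s `^ (p / (p + q)) <= 1 ->
      rho * (N%:R `^ p) ^+ 2 <= (2 `^ p) ^+ 2.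
Proof.
move=> s0 p0 q0; have pq0 : 0 < p + q by rewrite addr_gt0.
pose x := s `^ (2 * (p + q))^-1.
have x0 : 0 <= x by exact: powR_ge0.
have xpow e : (x `^ e) ^+ 2 = s `^ (e / (p + q)).
  rewrite /x -powR_mulrn ?powR_ge0// -!powRrM; congr (_ `^ _).
  by field; rewrite gt_eqF.
have /andP[_ xN] := truncn_itv x0; have /andP[Nx _] := truncn_itv x0.
exists (Num.truncn x).+1 => //; split.
  have -> : s = (x `^ (p + q)) ^+ 2 by rewrite xpow divff ?gt_eqF// powRr1.
  rewrite ler_sqr ?nnegrE ?powR_ge0//.
  by apply: ge0_ler_powR; rewrite ?nnegrE ?ler0n ?(ltW pq0)// ltW.
move=> rho rho0 rho1 rhos.
set N : R := (_.+1)%:R in xN *.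
have NE : N <= x + 1 by rewrite /N -natr1 lerD2r.
have N0 : 0 <= N by rewrite /N.
pose y := Num.max 1 x.
have N2y : N <= 2 * y by rewrite /y maxEle; case: ifP => ?; lra.
have y0 : 0 <= y by rewrite /y le_max ler01.
apply: (@le_trans _ _ (rho * ((2 `^ p) ^+ 2 * (y `^ p) ^+ 2))).
  apply: ler_wpM2l => //; rewrite -exprMn -powRM//.
  rewrite ler_sqr ?nnegrE ?powR_ge0//.
  by apply: ge0_ler_powR; rewrite ?nnegrE ?(ltW p0)// mulr_ge0.
rewrite mulrCA; apply: ler_piMr; first exact: sqr_ge0.
by rewrite /y maxEle; case: ifP => _; rewrite ?xpow// powR1 expr1n mulr1.
Qed.

Lemma private_rate_real d (beta a : R) n : 0 <= a ->
  exists rho, [/\ private_rate d beta a%:E n = rho%:E, 0 <= rho, rho <= 1 &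
    rho * (n%:R * (expR a - 1) ^+ 2) `^ (beta / (beta + d%:R)) <= 1].
Proof.
move=> a0; rewrite /private_rate /= inver.
set w := (n%:R * (expR a - 1) ^+ 2) `^ (beta / (beta + d%:R)).
have w0 : 0 <= w by exact: powR_ge0.
case: ifPn => [/eqP ->|wn0].
  by exists 1; split; rewrite ?mulr0 ?ler01.
have wp : 0 < w by rewrite lt0r wn0.
exists (Num.min w^-1 1); split.
- by rewrite EFin_min.
- by rewrite le_min invr_ge0 w0 ler01.
- by rewrite ge_min lexx orbT.
- by rewrite -ler_pdivlMr// mul1r ge_min lexx.
Qed.

Section cells.
Variables (d N : nat) (beta c : R).
Hypotheses (N_gt0 : (0 < N)%N) (beta_gt0 : 0 < beta).
Local Notation r := (radius N : R).

Let N_gt0R : 0 < N%:R :> R. Proof. by rewrite ltr0n. Qed.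
Let r_ge0 : 0 <= r. Proof. exact/ltW/radius_gt0. Qed.
Let rN2 : r * N%:R = 2^-1.
Proof. by have := @radiusE R N N_gt0; move: (radius N) (N%:R) => p q; lra. Qed.

(** With t N^(beta + d) <= c, the exponent n delta^2 is at most c^2 <= 1 / 4. *)
Lemma cell_budget (n : nat) (a : R) : 0 <= c -> c <= 2^-1 -> 0 <= a ->
  n%:R * (expR a - 1) ^+ 2 <= (N%:R `^ (beta + d%:R)) ^+ 2 ->
  (1 + ((expR a - 1) * (c * r `^ beta * (2 * r) ^+ d)) ^+ 2) ^+ n <= 2.
Proof.
move=> c0 c2 a0 sN; apply: expn1D_le2; last exact: sqr_ge0.
set t := c * r `^ beta * (2 * r) ^+ d.
have t0 : 0 <= t by rewrite !mulr_ge0 ?powR_ge0 ?exprn_ge0 ?mulr_ge0.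
have tN : t * N%:R `^ (beta + d%:R) <= c.
  rewrite powRD; last by apply/implyP => _; rewrite gt_eqF.
  rewrite powR_mulrn ?ler0n//.
  have -> : t * (N%:R `^ beta * N%:R ^+ d) =
      c * ((r * N%:R) `^ beta * (2 * r * N%:R) ^+ d).
    by rewrite (powRM _ r_ge0 (ltW N_gt0R)) (exprMn _ (2 * r)) /t; ring.
  have -> : 2 * r * N%:R = 1 by rewrite -mulrA rN2 divff.
  rewrite expr1n mulr1 ler_piMr//.
  apply: (@le_trans _ _ (1 `^ beta)); last by rewrite powR1.
  apply: ge0_ler_powR; rewrite ?nnegrE ?(ltW beta_gt0) ?mulr_ge0//.
  by rewrite rN2; lra.
have -> : n%:R * ((expR a - 1) * t) ^+ 2 = (n%:R * (expR a - 1) ^+ 2) * t ^+ 2 by ring.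
apply: le_trans (ler_wpM2r (sqr_ge0 t) sN) _.
rewrite -exprMn mulrC.
have T0 : 0 <= t * N%:R `^ (beta + d%:R) by rewrite mulr_ge0 ?powR_ge0.
move: (t * _) T0 tN => T T0 tN; nra.
Qed.

(** The cores have total volume N^d r^d = 2^-d and r / 2 = 1 / (4 N), so what is left
   is N^(-2 beta) >= rho / 2^(2 beta). *)
Lemma cell_constant (rho : R) : rho * (N%:R `^ beta) ^+ 2 <= (2 `^ beta) ^+ 2 ->
  2^-1 ^+ d * c ^+ 2 / 8 / (8 `^ beta) ^+ 2 * rho <=
  (N ^ d)%N%:R * ((c * (r / 2) `^ beta) ^+ 2 / 2 * r ^+ d / 2 / 2).
Proof.
move=> rhoN; set z := (r / 2) `^ beta.
have half : 2^-1 ^+ d = (N ^ d)%N%:R * r ^+ d :> R.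
  by rewrite natrX -exprMn mulrC rN2.
have zN : z * (N%:R `^ beta * 4 `^ beta) = 1.
  rewrite /z -powRM// -powRM ?mulr_ge0 ?divr_ge0//.
  have -> : r / 2 * (N%:R * 4) = r * N%:R * 2.
    by move: (radius N) (N%:R) => p q; field.
  by rewrite rN2 mulVf// powR1.
have e8 : 8 `^ beta = 2 `^ beta * 4 `^ beta :> R.
  by rewrite -powRM//; congr (_ `^ _); lra.
have p8 : 0 < (8 `^ beta) ^+ 2 :> R by rewrite exprn_gt0// powR_gt0.
have rhoz : rho <= z ^+ 2 * (8 `^ beta) ^+ 2.
  have := ler_wpM2r (sqr_ge0 (z * 4 `^ beta)) rhoN.
  rewrite (_ : rho * _ * _ = rho * (z * (N%:R `^ beta * 4 `^ beta)) ^+ 2); last by ring.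
  by rewrite zN expr1n mulr1 e8 => /le_trans; apply; rewrite le_eqVlt; apply/orP; left; apply/eqP; ring.
have -> : (N ^ d)%N%:R * ((c * z) ^+ 2 / 2 * r ^+ d / 2 / 2) =
    2^-1 ^+ d * c ^+ 2 / 8 * z ^+ 2 by rewrite half; field.
rewrite -mulrA; apply: ler_wpM2l.
  by rewrite divr_ge0// mulr_ge0 ?sqr_ge0// exprn_ge0// invr_ge0.
by rewrite mulrC ler_pdivrMr.
Qed.

End cells.

End rate.

Local Open Scope ereal_scope.

Theorem theorem4p1 (R : realType) (d : nat) (beta C M : R) :
  (1 <= d)%N -> (0 < beta)%R -> (beta <= 1)%R -> (0 < C)%R -> (0 < M)%R ->
  exists2 kappa : R, (0 < kappa)%R &
    forall (n : nat) (alpha : \bar R), (1 <= n)%N -> 0 <= alpha ->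
      kappa%:E * private_rate d beta alpha n <= minimax_risk d beta C M alpha n.
Proof.
move=> d1 beta0 beta1 C0 M0.
have beta01 : (0 < beta <= 1)%R by rewrite beta0.
(* The bound 1/2 keeps n delta^2 below 1/4. *)
pose c : R := Num.min (Num.min C M) 2^-1%R.
have c0 : (0 < c)%R by rewrite /c !lt_min C0 M0 /= invr_gt0 ltr0n.
have cC : (c <= C)%R by rewrite /c !ge_min lexx.
have cM : (c <= M)%R by rewrite /c !ge_min lexx orbT.
have c2 : (c <= 2^-1%R)%R by rewrite /c !ge_min lexx !orbT.
(* The factor that [cell_constant] leaves in front of the rate. *)
pose kappa : R := (2^-1 ^+ d * c ^+ 2 / 8 / (8 `^ beta) ^+ 2)%R.
have p8 : (0 < 8 `^ beta :> R)%R by rewrite powR_gt0.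
have kappa0 : (0 < kappa)%R by rewrite !divr_gt0 ?mulr_gt0 ?exprn_gt0 ?invr_gt0.
exists kappa => // n alpha n0; case: alpha => [a| |]//; last first.
  (* For alpha = +oo the rate is 0, and the supremum of the nonnegative risks is
     at least 0 because the class contains some function. *)
  move=> _; rewrite private_ratey// mule0.
  apply: le_ereal_inf_tmp => _ [dH [H [Q [mt [_ _ ->]]]]].
  pose m0 := @vertex_mfun R d 1 beta c beta01 c0 [ffun=> false].
  apply: (@le_trans _ _ (risk Q mt m0)).
    by apply: integral_ge0 => z _; apply: integral_ge0 => x _; rewrite lee_fin sqr_ge0.
  by apply: ereal_sup_ubound; exists m0 => //; exact: vertex_class.
rewrite lee_fin => a0.
set s : R := (n%:R * (expR a - 1) ^+ 2)%R.
have s0 : (0 <= s)%R by rewrite mulr_ge0// sqr_ge0.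
have dR : (0 < d%:R :> R)%R by rewrite ltr0n.
have [N N0 []] := grid_size s0 beta0 dR; rewrite /s => sN Nrho.
have [rho [-> rho0 rho1 rhos]] := private_rate_real d beta n a0.
have {Nrho rhos}Nrho := Nrho _ rho0 rho1 rhos.
have budget := @cell_budget R d N beta c N0 beta0 n a (ltW c0) c2 a0 sN.
have final := @cell_constant R d N beta c N0 rho Nrho.
apply: le_ereal_inf_tmp => _ [dH [H [Q [mt [Qa mtP ->]]]]].
rewrite -EFinM; apply: le_trans (_ : (_ <= _%:E)) _; first by rewrite lee_fin; exact: final.
apply: (risk_lower_bound N0 (beta01 := beta01) (c_gt0 := c0) cC cM a0 budget mtP Qa).
move=> theta; apply: ereal_sup_ubound; exists (vertex_mfun beta01 c0 theta) => //.
exact: vertex_class.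
Qed.
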